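(* Let $d\ge 1$, $T\in\mathbb{R}$, $\lambda\in\mathbb{R}^d$ with positive entries, $\alpha\in(\frac13,\frac12]$ and $\rho\in\mathbb{R}^d$ with $0<\rho^i<\lambda^i$ for all $i=1,\dots,d$. Then the EFM-signature has the fading memory property with respect to the exponentially weighted rough path distance $\varrho_{\alpha,\rho}$: for all $-\infty\le s\le t\le T$ and $n\ge0$, the map $\mathbf{X}\mapsto\mathbb{X}^{\lambda,n}_{s,t}$ is continuous on $(\mathscr{C}^{\alpha,\rho}((-\infty,T],\mathbb{R}^d),\varrho_{\alpha,\rho})$; that is, for $\mathbf{X},\mathbf{Y}\in\mathscr{C}^{\alpha,\rho}((-\infty,T],\mathbb{R}^d)$ (with $\mathbf{X}$ fixed), $$|\mathbb{X}^{\lambda,n}_{s,t}-\mathbb{Y}^{\lambda,n}_{s,t}|\to0\quad\text{as}\quad\varrho_{\alpha,\rho}(\mathbf{X},\mathbf{Y})\to0.$$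
   Context: Tensors. Words $v=i_1\cdots i_n$ over $\{1,\dots,d\}$ index the basis vectors of $(\mathbb{R}^d)^{\otimes n}$, and $(\mathbb{R}^d)^{\otimes 0}=\mathbb{R}$. For $\mu\in\mathbb{R}^d$ and a word $v=i_1\cdots i_n$ put $\mu^{v}=\sum_{k=1}^n\mu^{i_k}$ (and $0$ for the empty word). For $h\in\mathbb{R}$ the operator $\mathbf{D}^{\mu}_h$ acts on $(\mathbb{R}^d)^{\otimes n}$ diagonally: it multiplies the coefficient of the word $v$ by $e^{-\mu^{v}h}$. Write $\mathbf{D}_h=\mathbf{D}^{\lambda}_h$. $|\cdot|$ is the Euclidean norm on $(\mathbb{R}^d)^{\otimes n}$. Weighted norm: for two-parameter tensor-valued functions, $$\|A\|_{\alpha,\rho}=\sup_{u<v\le T,\ v-u<1}\frac{|\mathbf{D}^{\rho}_{T-u}A_{u,v}|}{|v-u|^{\alpha}}.$$ Rough paths. $\mathscr{C}^{\alpha,\rho}((-\infty,T],\mathbb{R}^d)$ is the set of pairs $\mathbf{X}=(\mathbb{X}^1,\mathbb{X}^2)$, where $\mathbb{X}^1_{s,t}=X_t-X_s\in\mathbb{R}^d$ is the increment of a path $X$ and $\mathbb{X}^2_{s,t}\in(\mathbb{R}^d)^{\otimes 2}$, with $\|\mathbb{X}^1\|_{\alpha,\rho}<\infty$, $\|\mathbb{X}^2\|_{2\alpha,\rho}<\infty$ and Chen's identity $\mathbb{X}^2_{s,t}=\mathbb{X}^2_{s,u}+\mathbb{X}^2_{u,t}+\mathbb{X}^1_{s,u}\otimes\mathbb{X}^1_{u,t}$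 for all $s\le u\le t\le T$. The distance is $$\varrho_{\alpha,\rho}(\mathbf{X},\mathbf{Y})=\|\mathbb{X}^1-\mathbb{Y}^1\|_{\alpha,\rho}+\|\mathbb{X}^2-\mathbb{Y}^2\|_{2\alpha,\rho}.$$ EFM-signature (exponentially fading memory signature) of $\mathbf X$. For paths $(Y,Y')$, with $Y$ valued in $(\mathbb{R}^d)^{\otimes n}$ and $Y'$ in $(\mathbb{R}^d)^{\otimes(n-1)}$ (with $Y'=0$ if $n=0$), and finite $r<t$, the rough convolution is $$\int_r^t\mathbf{D}_{t-u}(Y_u\,d\mathbf{X}_u)=\lim_{|\mathcal{P}|\to0}\sum_{[u,v]\in\mathcal{P}}\mathbf{D}_{t-u}\big(Y_u\otimes\mathbb{X}^1_{u,v}+Y'_u\otimes\mathbb{X}^2_{u,v}\big),$$ the limit being over partitions $\mathcal P$ of $[r,t]$ with mesh tending to $0$, and $\int_{-\infty}^t:=\lim_{R\to-\infty}\int_R^t$. The EFM-signature is defined recursively by $\mathbb{X}^{\lambda,0}_{s,t}=1$ and $$\mathbb{X}^{\lambda,n+1}_{s,t}=\int_s^t\mathbf{D}_{t-u}(\mathbb{X}^{\lambda,n}_{s,u}\,d\mathbf{X}_u),\qquad -\infty\le s\le t\le T,$$ taking $Y_u=\mathbb{X}^{\lambda,n}_{s,u}$ and $Y'_u=\mathbb{X}^{\lambda,n-1}_{s,u}$ (with $\mathbb{X}^{\lambda,-1}:=0$). For $\mathbf{X}\in\mathscr{C}^{\alpha,\rho}$ with $0<\rho^i<\lambda^i$ for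 all $i$, all these limits exist. $\mathbb{Y}^{\lambda,n}_{s,t}$ denotes the EFM-signature of $\mathbf{Y}$. *)

(* Defs.v *)
From HB Require Import structures.
From mathcomp Require Import all_boot all_order all_algebra.
From mathcomp Require Import all_classical all_reals all_analysis.
Set Implicit Arguments.
Unset Strict Implicit.
Unset Printing Implicit Defensive.
Import Order.TTheory GRing.Theory Num.Theory.
Import numFieldNormedType.Exports.
Local Open Scope classical_set_scope.
Local Open Scope ring_scope.

Definition word (d n : nat) := {ffun 'I_n -> 'I_d}.

(* An element of (R^d)^{(x) n}, given by its coefficients on words. Vectors
   of R^d that enter tensor products are elements of [tensor R d 1]. *)
Definition tensor (R : realType) (d n : nat) := {ffun word d n -> R}.

Section Tensors.
Variables (R : realType) (d : nat).

Definition tone : tensor R d 0 := [ffun=> 1].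

Definition tnorm n (A : tensor R d n) : R := Num.sqrt (\sum_w A w ^+ 2).

(* The tensor product, with the degree of the result given up to a proof of
   equality: the coefficient on a word is the coefficient of A on its first n
   letters times the coefficient of B on its last m letters. *)
Definition tmul n m p (e : (n + m)%N = p) (A : tensor R d n) (B : tensor R d m)
    : tensor R d p :=
  [ffun w : word d p =>
     A [ffun i => w (cast_ord e (lshift m i))] *
     B [ffun j => w (cast_ord e (rshift n j))]].

Definition wordsum n (mu : 'rV[R]_d) (w : word d n) : R :=
  \sum_(k < n) mu 0 (w k).

Definition Dop (mu : 'rV[R]_d) (h : R) n (A : tensor R d n) : tensor R d n :=
  [ffun w => expR (- (wordsum mu w * h)) * A w].

(* Limit with respect to the Euclidean norm; 0 if there is no limit. *)
Definition tlim (I : Type) (F : set_system I) n (f : I -> tensor R d n)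
    : tensor R d n :=
  xget 0 [set L | tnorm (f x - L) @[x --> F] --> (0 : R)].

End Tensors.

Section RoughPaths.
Variables (R : realType) (d : nat).

(* Only the values at s <= t <= T are ever constrained or used. *)
Record two_level := TwoLevel {
  lev1 : R -> R -> tensor R d 1;
  lev2 : R -> R -> tensor R d 2 }.

Definition wnorm (T : R) (rho : 'rV[R]_d) (alpha : R) n
    (A : R -> R -> tensor R d n) : \bar R :=
  ereal_sup [set x | exists u v : R, [/\ u < v, v <= T, v - u < 1 &
    x = (tnorm (Dop rho (T - u) (A u v)) / `|v - u| `^ alpha)%:E]].

Definition rough_path (T alpha : R) (rho : 'rV[R]_d) : set two_level :=
  [set X | [/\
     exists x : R -> tensor R d 1, forall s t, s <= t -> t <= T ->
       lev1 X s t = x t - x s,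
     (wnorm T rho alpha (lev1 X) < +oo)%E,
     (wnorm T rho (2 * alpha)%R (lev2 X) < +oo)%E &
     forall s u t, s <= u -> u <= t -> t <= T ->
       lev2 X s t = lev2 X s u + lev2 X u t +
                    tmul (erefl : (1 + 1 = 2)%N) (lev1 X s u) (lev1 X u t)]].

Definition rough_dist (T alpha : R) (rho : 'rV[R]_d) (X Y : two_level)
    : \bar R :=
  (wnorm T rho alpha (fun s t => lev1 X s t - lev1 Y s t)%R +
   wnorm T rho (2 * alpha)%R (fun s t => lev2 X s t - lev2 Y s t)%R)%E.

(* A partition r = p_0 < p_1 < ... < p_k = t is encoded, as in
   [itv_partition], by the sequence P = [:: p_1; ...; p_k]. *)
Definition subintervals (r : R) (P : seq R) : seq (R * R) := zip (r :: P) P.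

Definition mesh (r : R) (P : seq R) : R :=
  \big[Num.max/0]_(uv <- subintervals r P) (uv.2 - uv.1).

Definition mesh_to0 (r t : R) : set_system (seq R) :=
  filter_from [set e : R | 0 < e]
    (fun e => [set P | itv_partition r t P /\ mesh r P < e]).

(* Y' (x) X^2, where Y' has degree n - 1; there is no such term if n = 0. *)
Definition tmul2 n : tensor R d n.-1 -> tensor R d 2 -> tensor R d n.+1 :=
  match n with
  | 0 => fun _ _ => 0
  | k.+1 => fun Y' x2 => tmul (addn2 k) Y' x2
  end.

Definition rough_sum (lam : 'rV[R]_d) (X : two_level) n
    (Y : R -> tensor R d n) (Y' : R -> tensor R d n.-1) (r t : R) (P : seq R)
    : tensor R d n.+1 :=
  \sum_(uv <- subintervals r P)
    Dop lam (t - uv.1)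
      (tmul (addn1 n) (Y uv.1) (lev1 X uv.1 uv.2) +
       tmul2 (Y' uv.1) (lev2 X uv.1 uv.2)).

Definition rough_conv_fin (lam : 'rV[R]_d) (X : two_level) n
    (Y : R -> tensor R d n) (Y' : R -> tensor R d n.-1) (r t : R)
    : tensor R d n.+1 :=
  tlim (mesh_to0 r t) (rough_sum lam X Y Y' r t).

(* The lower bound s is a real number or -oo; +oo is a dummy case. *)
Definition rough_conv (lam : 'rV[R]_d) (X : two_level) n
    (Y : R -> tensor R d n) (Y' : R -> tensor R d n.-1) (s : \bar R) (t : R)
    : tensor R d n.+1 :=
  match s with
  | r%:E => rough_conv_fin lam X Y Y' r t
  | -oo%E => tlim (-oo%R : set_system R)
               (fun r => rough_conv_fin lam X Y Y' r t)
  | +oo%E => 0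
  end.

(* The levels n and n - 1 of u |-> X^{lam, .}_{s, u}, level -1 being 0. *)
Fixpoint efm_pair (lam : 'rV[R]_d) (X : two_level) (s : \bar R) (n : nat)
    : (R -> tensor R d n) * (R -> tensor R d n.-1) :=
  match n with
  | 0 => (fun=> tone R d, fun=> 0)
  | k.+1 => let YY' := efm_pair lam X s k in
            (rough_conv lam X YY'.1 YY'.2 s, YY'.1)
  end.

Definition efm_sig (lam : 'rV[R]_d) (X : two_level) (n : nat)
    (s : \bar R) (t : R) : tensor R d n := (efm_pair lam X s n).1 t.

End RoughPaths.

(* Main.v *)
Require Import Defs.
From HB Require Import structures.
From mathcomp Require Import all_boot all_order all_algebra.
From mathcomp Require Import all_classical all_reals all_analysis.
From mathcomp Require Import ring lra.
Import Order.TTheory GRing.Theory Num.Theory.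
Import numFieldNormedType.Exports.
Local Open Scope classical_set_scope.
Local Open Scope ring_scope.

Set Implicit Arguments.
Unset Strict Implicit.
Unset Printing Implicit Defensive.

(** Each coefficient of the signature is a sum of exponentially damped iterated
    integrals. Multiplying the coefficient of a word [w] at time [u] by
    [exp (lam^w u)] turns the damped convolutions into ordinary rough integrals of
    germs [z_u a_{u,v} + z'_u b_{u,v}], where [z] and [z'] are two consecutive undamped
    levels and [a] and [b] are the undamped increments of the rough path. The
    undamped increments satisfy additivity and Chen's identity up to errors of
    order [3 alpha > 1], and as [rho^i < lam^i] they are bounded by a
    multiple of [fade u], an exponential that decays as [u] tends to [-oo]
    ([rough_path_almost_rough]). All constants depend only on a bound for the rough
    path, hence are the same for all paths in a ball around [X].

    The sewing lemma ([maximal_inequality], [sewing_quantitative]) integrates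
    germs with a defect of order greater than one, and compares the integral with any
    partition sum, with an explicit error. The fading weight makes the
    integrals over successive pieces of the past summable as a geometric series, so
    that integrals from [-oo] exist and are bounded, with a tail that is
    uniformly small ([primitive_exists]). If [z] is controlled by [z'], then
    its integral is controlled by [z] ([primitive_controlled]); induction gives all
    levels of the signature ([efm_primitive], [efm_controlled]).

    No stability estimate for rough integrals is required for continuity. Given an
    error, one partition of a bounded interval approximates the next level of
    the signature for all paths in the ball at once
    ([uniform_partition_approximation]). The sum over this fixed partition
    is a polynomial in finitely many increments of the path, which converge with the
    distance, and in the values of lower levels at finitely many times, which converge
    by induction ([nsig_cvg]). A uniform limit of continuous functions is
    continuous. *)

(** * Partitions and Riemann sums *)

Section Partitions.
Context {R : realType}.
Implicit Types (Xi : R -> R -> R) (r t u v c D : R) (P Q : seq R).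

Definition psum Xi r P : R := \sum_(uv <- subintervals r P) Xi uv.1 uv.2.

(** For positive [D] this is [mesh r P < D], in a form that splits along a
    concatenation of partitions. *)
Definition finer_than D r P : bool :=
  all (fun uv : R * R => uv.2 - uv.1 < D) (subintervals r P).

Lemma subintervals_cat r P Q :
  subintervals r (P ++ Q) = subintervals r P ++ subintervals (last r P) Q.
Proof.
elim: P r => [|p P IH] r //=.
by rewrite /subintervals /= in IH *; rewrite IH.
Qed.

Lemma psum_nil Xi r : psum Xi r [::] = 0.
Proof. by rewrite /psum big_nil. Qed.

Lemma psum_cons Xi r p P : psum Xi r (p :: P) = Xi r p + psum Xi p P.
Proof. by rewrite /psum [subintervals _ _]/= big_cons. Qed.

Lemma psum_cat Xi r P Q : psum Xi r (P ++ Q) = psum Xi r P + psum Xi (last r P) Q.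
Proof. by rewrite /psum subintervals_cat big_cat. Qed.

Lemma finer_than_cons D r p P :
  finer_than D r (p :: P) = (p - r < D) && finer_than D p P.
Proof. by []. Qed.

Lemma finer_than_cat D r P Q :
  finer_than D r (P ++ Q) = finer_than D r P && finer_than D (last r P) Q.
Proof. by rewrite /finer_than subintervals_cat all_cat. Qed.

Lemma finer_thanW D D' r P : D <= D' -> finer_than D r P -> finer_than D' r P.
Proof. by move=> DD' /allP h; apply/allP => uv /h /lt_le_trans; exact. Qed.

Lemma itv_partition_catE r t P Q :
  itv_partition r t (P ++ Q) <->
  itv_partition r (last r P) P /\ itv_partition (last r P) t Q.
Proof.
rewrite /itv_partition cat_path last_cat eqxx; split.
  by move=> [/andP[-> ->] ->].
by move=> [[-> _] [-> ->]].
Qed.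

Lemma itv_partition_consE r t p P :
  itv_partition r t (p :: P) <-> r < p /\ itv_partition p t P.
Proof.
rewrite /itv_partition /=; split; first by move=> [/andP[-> ->] ->].
by move=> [-> [-> ->]].
Qed.

Lemma finer_than_mesh D r P : 0 < D -> finer_than D r P -> mesh r P < D.
Proof.
move=> D0 /allP h; rewrite /mesh big_seq_cond; apply: bigmax_lt => //.
by move=> uv; rewrite andbT => /h.
Qed.

Lemma mesh_finer_than D r P : mesh r P < D -> finer_than D r P.
Proof.
move=> h; apply/allP => uv uvP; apply: le_lt_trans h.
by apply: (@Order.TotalTheory.bigmax_sup_seq _ _ _ _ _ uv).
Qed.

Lemma finer_partition_exists D r t : 0 < D -> r <= t ->
  exists2 P, itv_partition r t P & finer_than D r P.
Proof.
move=> D0.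
(* steps of length [D / 2], since the bound [D] is strict *)
suff H n : forall r, r <= t -> t - r <= n%:R * (D / 2) ->
    exists2 P, itv_partition r t P & finer_than D r P.
  move=> rt; apply: (H (Num.truncn ((t - r) / (D / 2))).+1) => //.
  rewrite -ler_pdivrMr ?divr_gt0//; apply/ltW/truncnS_gt.
elim: n => [|n IH] {}r rt h.
  have -> : r = t by lra.
  by exists [::] => //; split.
have [h1|h1] := leP (t - r) (D / 2).
  have [->|rt'] := eqVneq r t; first by exists [::] => //; split.
  exists [:: t]; first by apply: itv_partition1; rewrite lt_neqAle rt'.
  by rewrite finer_than_cons andbT; lra.
have [||P Pp Pf] := IH (r + D / 2).
- by lra.
- by move: h; rewrite -natr1 mulrDl mul1r; lra.
exists (r + D / 2 :: P).
  by apply/itv_partition_consE; split => //; lra.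
by rewrite finer_than_cons Pf andbT; lra.
Qed.

(** With [c] the midpoint of the interval, the pieces of the partition before and
    after [x] each cover at most half of it, which is what the induction in the
    maximal inequality needs. *)
Lemma path_split_at u c P : path <%R u P -> u <= c < last u P ->
  exists P1 x P2, P = P1 ++ x :: P2 /\ last u P1 <= c < x.
Proof.
elim: P u => [|p P IH] u /=; first by move=> _ /andP[/le_lt_trans] /[apply]; rewrite ltxx.
move=> /andP[up pP] /andP[uc cl].
have [cp|pc] := ltP c p; first by exists [::], p, P; rewrite /= uc cp.
have [|P1 [x [P2 [-> h]]]] := IH p pP; first by rewrite pc cl.
by exists (p :: P1), x, P2.
Qed.

Lemma itv_partition_sub_ge r t P x : itv_partition r t P -> x \in P -> r < x <= t.
Proof.
move=> [+ /eqP].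
elim: P r => [//|p P IH] r /= /andP[rp pP] lt.
rewrite inE => /orP[/eqP ->|xP].
  rewrite rp; apply: (@itv_partition_le _ _ _ _ P); split => //; exact/eqP.
by have /andP[px ->] := IH p pP lt xP; rewrite (lt_trans rp px).
Qed.

(** Two partitions are compared through a third one that contains the points of
    both; this is what makes the Riemann sums of a germ a Cauchy family. *)
Lemma common_refinement r t P Q : itv_partition r t P -> itv_partition r t Q ->
  exists N, [/\ itv_partition r t N, {subset P <= N} & {subset Q <= N}].
Proof.
move=> hP hQ; set N := sort <=%O (undup (P ++ Q)).
have NE x : (x \in N) = (x \in P) || (x \in Q).
  by rewrite mem_sort mem_undup mem_cat.
have rN : path <%R r N.
  rewrite (path_sortedE lt_trans); apply/andP; split.
    apply/allP => x; rewrite NE => /orP[xP|xQ].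
      by have /andP[] := itv_partition_sub_ge hP xP.
    by have /andP[] := itv_partition_sub_ge hQ xQ.
  by rewrite /N sort_lt_sorted undup_uniq.
exists N; split; try by move=> x h; rewrite NE h ?orbT.
split=> //; rewrite eq_le; apply/andP; split.
  have := mem_last r N; rewrite inE => /orP[/eqP ->|]; first exact: itv_partition_le hP.
  rewrite NE => /orP[xP|xQ].
    by have /andP[] := itv_partition_sub_ge hP xP.
  by have /andP[] := itv_partition_sub_ge hQ xQ.
have [e|rt] := eqVneq r t.
  rewrite -{1}e; have hN : itv_partition r (last r N) N by split.
  exact: itv_partition_le hN.
have tN : t \in N.
  rewrite NE; have [_ /eqP lP] := hP; have := mem_last r P.
  by rewrite lP inE eq_sym (negbTE rt) /= => ->.
have hN : itv_partition r (last r N) N by split.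
by have /andP[] := itv_partition_sub_ge hN tN.
Qed.

End Partitions.

(** * The sewing lemma *)

(** The solution [c] of [c = 2 * 2^-th * c + 2]: halving an interval reproduces the
    bound [c * h^th] on both halves and costs two defects of size [h^th]. *)
HB.lock Definition sew_const (R : realType) (th : R) : R :=
  2 / (1 - 2 * 2^-1 `^ th).

Section Sewing.
Context {R : realType}.
Implicit Types (Xi : R -> R -> R) (r t u v c D K th L : R) (P Q : seq R).

(** A germ need only be almost additive, on intervals of length less than one,
    since the seminorms on rough paths only see such intervals. *)
Definition sewable K th r t Xi := forall u m v,
  r <= u -> u <= m -> m <= v -> v <= t -> v - u < 1 ->
  `|Xi u v - Xi u m - Xi m v| <= K * (v - u) `^ th.

Definition sewn Xi r t L := forall eps, 0 < eps -> exists2 D, 0 < D &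
  forall P, itv_partition r t P -> finer_than D r P -> `|psum Xi r P - L| < eps.

Definition pow_gap th u v : R := (v - u) `^ th.

Lemma half_powR_lt th : 1 < th -> 2 * (2^-1 : R) `^ th < 1.
Proof.
move=> th1; have l0 : ln (2^-1 : R) < 0 by rewrite ln_lt0// invr_gt0 invf_lt1 ?ltr0n// ltr1n andbT.
have : (2^-1 : R) `^ th < 2^-1 `^ 1.
  by rewrite /powR invr_eq0 pnatr_eq0 ltr_expR ltr_nM2r.
by rewrite powRr1 ?invr_ge0//; lra.
Qed.

Lemma sew_const_ge0 th : 1 < th -> 0 <= sew_const th.
Proof. by move/half_powR_lt => h; rewrite unlock divr_ge0// subr_ge0 ltW. Qed.

Lemma sew_constE th : 1 < th ->
  sew_const th = 2 * 2^-1 `^ th * sew_const th + 2.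
Proof.
move=> /half_powR_lt h; rewrite unlock; field.
by rewrite subr_eq0 eq_sym lt_eqF.
Qed.

Lemma sewable_diag K th r t Xi u : 1 < th -> sewable K th r t Xi ->
  r <= u -> u <= t -> Xi u u = 0.
Proof.
move=> th1 /(_ u u u) h ru ut; move: h.
rewrite !subrr powR0 ?mulr0; last by rewrite gt_eqF// (lt_trans ltr01).
move=> /(_ ru (lexx _) (lexx _) ut ltr01).
by rewrite normr_le0 sub0r oppr_eq0 => /eqP.
Qed.

Lemma sewable_sub K th r t r' t' Xi :
  r <= r' -> t' <= t -> sewable K th r t Xi -> sewable K th r' t' Xi.
Proof.
move=> rr tt h u m v ru um mv vt; apply: h => //; first exact: le_trans ru.
exact: le_trans tt.
Qed.

(** Induction on the number of points. The partition is split at the step that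
    crosses the midpoint of [u, v], so that what is left on each side has length
    at most [(v - u) / 2]; as [th > 1], the two halves together weigh the factor
    [2 * 2^-th < 1], which absorbs the two defects made by the splitting. *)
Lemma maximal_inequality K th r t Xi : 1 < th -> 0 <= K ->
  sewable K th r t Xi ->
  forall P u v, itv_partition u v P -> r <= u -> v <= t -> v - u < 1 ->
  `|psum Xi u P - Xi u v| <= sew_const th * K * (v - u) `^ th.
Proof.
move=> th1 K0 hX P; have [n] := ubnP (size P); elim: n P => // n IH P sP u v hP ru vt uv1.
have uv := itv_partition_le hP.
have c0 := sew_const_ge0 th1.
have [e|nuv] := eqVneq u v.
  move: hP; rewrite -e => /itv_partitionxx ->.
  rewrite psum_nil (sewable_diag th1 hX)//; last by lra.
  by rewrite subr0 normr0; apply: mulr_ge0; [exact: mulr_ge0|exact: powR_ge0].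
have ltuv : u < v by rewrite lt_neqAle nuv.
have [pP /eqP lP] := hP.
have [|P1 [x [P2 [PE /andP[h1 h2]]]]] := @path_split_at R u ((u + v) / 2) P pP.
  by rewrite lP; lra.
set p := last u P1 in h1.
move: hP; rewrite PE => /itv_partition_catE[hP1 /itv_partition_consE[px hP2]].
rewrite -/p in hP1 px.
have up := itv_partition_le hP1; have xv := itv_partition_le hP2.
move: sP; rewrite PE size_cat /= => sP.
have I1 : `|psum Xi u P1 - Xi u p| <= sew_const th * K * (p - u) `^ th.
  by apply: IH => //; try lra; move: sP; rewrite addnS ltnS; apply: leq_trans; rewrite ltnS leq_addr.
have I2 : `|psum Xi x P2 - Xi x v| <= sew_const th * K * (v - x) `^ th.
  by apply: IH => //; try lra; move: sP; rewrite addnS ltnS; apply: leq_trans; rewrite ltnS leq_addl.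
have D1 : `|Xi u v - Xi u p - Xi p v| <= K * (v - u) `^ th by apply: hX => //; lra.
have D2 : `|Xi p v - Xi p x - Xi x v| <= K * (v - p) `^ th by apply: hX => //; lra.
have th0 : 0 <= th by lra.
have mono (a b : R) : 0 <= a -> a <= b -> a `^ th <= b `^ th.
  move=> a0 ab; apply: ge0_ler_powR => //; rewrite nnegrE//; exact: le_trans ab.
have half : ((v - u) / 2) `^ th = (v - u) `^ th * 2^-1 `^ th.
  by rewrite powRM ?subr_ge0 ?invr_ge0.
have M1 : (p - u) `^ th <= (v - u) `^ th * 2^-1 `^ th by rewrite -half; apply: mono; lra.
have M2 : (v - x) `^ th <= (v - u) `^ th * 2^-1 `^ th by rewrite -half; apply: mono; lra.
have M3 : (v - p) `^ th <= (v - u) `^ th by apply: mono; lra.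
have cK : 0 <= sew_const th * K by exact: mulr_ge0.
have N1 := ler_wpM2l cK M1; have N2 := ler_wpM2l cK M2; have N3 := ler_wpM2l K0 M3.
rewrite psum_cat psum_cons -/p.
have -> : sew_const th * K * (v - u) `^ th =
    sew_const th * K * ((v - u) `^ th * 2^-1 `^ th) +
    sew_const th * K * ((v - u) `^ th * 2^-1 `^ th) +
    (K * (v - u) `^ th + K * (v - u) `^ th).
  by rewrite {1}sew_constE//; ring.
move: I1 I2 D1 D2 N1 N2 N3; rewrite !ler_norml => /andP[? ?] /andP[? ?] /andP[? ?] /andP[? ?].
by move=> *; apply/andP; split; lra.
Qed.

(** The maximal inequality in each interval of the coarser partition [P]. *)
Lemma refinement_estimate K th r t Xi P N : 1 < th -> 0 <= K ->
  sewable K th r t Xi -> itv_partition r t P -> itv_partition r t N ->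
  {subset P <= N} -> finer_than 1 r P ->
  `|psum Xi r P - psum Xi r N| <= sew_const th * K * psum (pow_gap th) r P.
Proof.
move=> th1 K0; elim: P r N => [|p P IH] r N hX hP hN PN.
  have e := itv_partition_nil hP; move: hN; rewrite -e => /itv_partitionxx ->.
  by rewrite !psum_nil subrr normr0 mulr0.
rewrite finer_than_cons => /andP[rp1 fP].
move: hP => /itv_partition_consE[rp hP].
have pt := itv_partition_le hP.
have pN : p \in N by apply: PN; rewrite inE eqxx.
case/splitPr: N / pN hN PN => N1 N2; rewrite -cat_rcons => /itv_partition_catE.
rewrite last_rcons => -[hN1 hN2] PN.
have PN2 : {subset P <= N2}.
  move=> x xP; have /andP[px _] := itv_partition_sub_ge hP xP.
  have := PN x; rewrite inE xP orbT => /(_ isT).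
  rewrite mem_cat => /orP[xN1|//].
  by have /andP[_ /(lt_le_trans px)] := itv_partition_sub_ge hN1 xN1; rewrite ltxx.
have I1 := IH p N2 (sewable_sub (ltW rp) (lexx _) hX) hP hN2 PN2 fP.
have I2 := maximal_inequality th1 K0 hX hN1 (lexx _) pt rp1.
rewrite psum_cat last_rcons !psum_cons mulrDr {1}/pow_gap.
move: I1 I2; rewrite !ler_norml => /andP[? ?] /andP[? ?].
by apply/andP; split; lra.
Qed.

Lemma psum_pow_gap_le th D r t P : 1 < th -> 0 <= D ->
  itv_partition r t P -> finer_than D r P ->
  psum (pow_gap th) r P <= (t - r) * D `^ (th - 1).
Proof.
move=> th1 D0; elim: P r => [|p P IH] r.
  by move/itv_partition_nil => ->; rewrite psum_nil subrr mul0r.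
move=> /itv_partition_consE[rp hP]; rewrite finer_than_cons => /andP[rpD fP].
rewrite psum_cons; have := IH p hP fP.
suff : pow_gap th r p <= (p - r) * D `^ (th - 1) by lra.
rewrite /pow_gap -mulr_powRB1; [|lra..].
rewrite ler_wpM2l ?subr_ge0 ?(ltW rp)//.
by apply: ge0_ler_powR; rewrite ?nnegrE; lra.
Qed.

(** Since [th > 1], the sum of the [th]-th powers of the steps is at most
    [(t - r) * D^(th - 1)] when all steps are shorter than [D]. *)
Lemma psum_pow_gap_small th eps c r t : 1 < th -> 0 < eps -> r <= t -> 0 <= c ->
  exists2 D, 0 < D <= 1 & forall P, itv_partition r t P -> finer_than D r P ->
    c * psum (pow_gap th) r P < eps.
Proof.
move=> th1 e0 rt c0.
have th10 : 0 < th - 1 by lra.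
set a := c * (t - r) + 1.
have a0 : 0 < a by rewrite ltr_wpDl// mulr_ge0// subr_ge0.
have ea0 : 0 < eps / a by rewrite divr_gt0.
set D := Num.min 1 ((eps / a) `^ (th - 1)^-1).
have D0 : 0 < D by rewrite lt_min ltr01 powR_gt0.
exists D; first by rewrite D0 ge_min lexx.
move=> P hP fP.
have h := psum_pow_gap_le th1 (ltW D0) hP fP.
have hD : D `^ (th - 1) <= eps / a.
  have -> : eps / a = ((eps / a) `^ (th - 1)^-1) `^ (th - 1).
    by rewrite -powRrM mulVf ?lt0r_neq0// powRr1// ltW.
  apply: ge0_ler_powR; rewrite ?nnegrE ?(ltW th10) ?(ltW D0) ?powR_ge0//.
  by rewrite /D ge_min lexx orbT.
apply: (le_lt_trans (ler_wpM2l c0 h)).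
have h3 : c * ((t - r) * D `^ (th - 1)) <= c * (t - r) * (eps / a).
  by rewrite mulrA ler_wpM2l// mulr_ge0// subr_ge0.
apply: (le_lt_trans h3).
by rewrite mulrA ltr_pdivrMr// mulrC ltr_pM2l// /a; lra.
Qed.

(** Intervals of the line that meet pairwise have a common point, by completeness.
    It produces limits together with their rate of convergence, without a
    detour through Cauchy filters. *)
Lemma common_point (I : Type) (A : set I) (x e : I -> R) : A !=set0 ->
  (forall i j, A i -> A j -> x i - e i <= x j + e j) ->
  exists L, forall i, A i -> `|x i - L| <= e i.
Proof.
move=> [i0 Ai0] h; exists (sup [set x i - e i | i in A]) => i Ai.
have hub : has_ubound [set x i - e i | i in A].
  by exists (x i0 + e i0) => _ [j Aj <-]; exact: h.
have h1 : x i - e i <= sup [set x i - e i | i in A].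
  by apply: ub_le_sup => //; exists i.
have h2 : sup [set x i - e i | i in A] <= x i + e i.
  apply: ge_sup; first by exists (x i0 - e i0), i0.
  by move=> _ [j Aj <-]; exact: h.
by rewrite ler_distl; apply/andP; split; lra.
Qed.

(** The common refinement of [P] and [Q] shows that the intervals around the
    Riemann sums, with radius the bound of the refinement estimate, meet
    pairwise. *)
Lemma sewing_quantitative K th r t Xi : 1 < th -> 0 <= K -> r <= t ->
  sewable K th r t Xi ->
  exists L, forall P, itv_partition r t P -> finer_than 1 r P ->
    `|psum Xi r P - L| <= sew_const th * K * psum (pow_gap th) r P.
Proof.
move=> th1 K0 rt hX.
have [||L hL] := @common_point _ [set P | itv_partition r t P /\ finer_than 1 r P]
  (psum Xi r) (fun P => sew_const th * K * psum (pow_gap th) r P).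
- have [P hP fP] := @finer_partition_exists R 1 r t ltr01 rt; by exists P.
- move=> P Q [hP fP] [hQ fQ]; have [N [hN PN QN]] := common_refinement hP hQ.
  have := refinement_estimate th1 K0 hX hP hN PN fP.
  have := refinement_estimate th1 K0 hX hQ hN QN fQ.
  by rewrite !ler_norml => /andP[? ?] /andP[? ?]; lra.
by exists L => P hP fP; apply: hL.
Qed.

Lemma sewn_unique r t Xi L L' : r <= t -> sewn Xi r t L -> sewn Xi r t L' -> L = L'.
Proof.
move=> rt h h'; apply/eqP; rewrite -subr_eq0 -normr_le0 leNgt; apply/negP => e0.
have e20 : 0 < `|L - L'| / 2 by rewrite divr_gt0.
have [D D0 hD] := h _ e20; have [D' D0' hD'] := h' _ e20.
have m0 : 0 < Num.min D D' by rewrite lt_min D0.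
have [P hP fP] := finer_partition_exists m0 rt.
have h1 := hD P hP (finer_thanW (_ : Num.min D D' <= D) fP).
have h2 := hD' P hP (finer_thanW (_ : Num.min D D' <= D') fP).
have {}h1 : `|psum Xi r P - L| < `|L - L'| / 2 by apply: h1; rewrite ge_min lexx.
have {}h2 : `|psum Xi r P - L'| < `|L - L'| / 2 by apply: h2; rewrite ge_min lexx orbT.
have := ler_distD (psum Xi r P) L L'; rewrite (distrC L (psum _ _ _)).
by move: h1 h2; lra.
Qed.

Lemma sewn_add r u t Xi L1 L2 L : r <= u -> u <= t ->
  sewn Xi r u L1 -> sewn Xi u t L2 -> sewn Xi r t L -> L = L1 + L2.
Proof.
move=> ru ut h1 h2 h3; apply: (sewn_unique (le_trans ru ut) h3).
move=> eps e0.
have e40 : 0 < eps / 4 by rewrite divr_gt0.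
have [D1 D10 hD1] := h1 _ e40; have [D2 D20 hD2] := h2 _ e40; have [D3 D30 hD3] := h3 _ e40.
exists D3 => // Q hQ fQ.
have m0 : 0 < Num.min D1 (Num.min D2 D3) by rewrite !lt_min D10 D20.
have [P1 hP1 fP1] := finer_partition_exists m0 ru.
have [P2 hP2 fP2] := finer_partition_exists m0 ut.
have lP1 : last r P1 = u by have [_ /eqP] := hP1.
have W1 : Num.min D1 (Num.min D2 D3) <= D1 by rewrite ge_min lexx.
have W2 : Num.min D1 (Num.min D2 D3) <= D2 by rewrite !ge_min lexx !orbT.
have W3 : Num.min D1 (Num.min D2 D3) <= D3 by rewrite !ge_min lexx !orbT.
have a1 := hD1 _ hP1 (finer_thanW W1 fP1).
have a2 := hD2 _ hP2 (finer_thanW W2 fP2).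
have a3 : `|psum Xi r (P1 ++ P2) - L| < eps / 4.
  apply: hD3; first by apply/itv_partition_catE; rewrite lP1.
  by rewrite finer_than_cat lP1 (finer_thanW W3 fP1) (finer_thanW W3 fP2).
have a4 := hD3 _ hQ fQ.
move: a3; rewrite psum_cat lP1.
move: a1 a2 a4; rewrite !ltr_norml => /andP[? ?] /andP[? ?] /andP[? ?] /andP[? ?].
by apply/andP; split; lra.
Qed.

Lemma sewing K th r t Xi : 1 < th -> 0 <= K -> r <= t -> sewable K th r t Xi ->
  exists L, sewn Xi r t L.
Proof.
move=> th1 K0 rt hX; have [L hL] := sewing_quantitative th1 K0 rt hX.
exists L => eps e0.
have c0 := mulr_ge0 (sew_const_ge0 th1) K0.
have [D /andP[D0 D1] hD] := psum_pow_gap_small th1 e0 rt c0.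
exists D => // P hP fP; apply: le_lt_trans (hD P hP fP).
by apply: hL => //; exact: finer_thanW fP.
Qed.

(** The limit does not depend on [K], so this estimate may be used on a
    subinterval with the better constant that holds there. *)
Lemma sewn_estimate K th r t Xi L : 1 < th -> 0 <= K -> r <= t ->
  sewable K th r t Xi -> sewn Xi r t L ->
  forall P, itv_partition r t P -> finer_than 1 r P ->
    `|psum Xi r P - L| <= sew_const th * K * psum (pow_gap th) r P.
Proof.
move=> th1 K0 rt hX hL; have [L' hL'] := sewing_quantitative th1 K0 rt hX.
suff -> : L = L' by [].
apply: (sewn_unique rt hL) => eps e0.
have c0 := mulr_ge0 (sew_const_ge0 th1) K0.
have [D /andP[D0 D1] hD] := psum_pow_gap_small th1 e0 rt c0.
exists D => // P hP fP; apply: le_lt_trans (hD P hP fP).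
by apply: hL' => //; exact: finer_thanW fP.
Qed.

Lemma sewn_local K th r t Xi L : 1 < th -> 0 <= K -> r <= t -> t - r < 1 ->
  sewable K th r t Xi -> sewn Xi r t L ->
  `|Xi r t - L| <= sew_const th * K * (t - r) `^ th.
Proof.
move=> th1 K0 rt rt1 hX hL.
have [e|nrt] := eqVneq r t.
  have := sewn_estimate th1 K0 rt hX hL (P := [::]) _ isT.
  rewrite -e subrr (sewable_diag th1 hX)// !psum_nil powR0 ?gt_eqF ?(lt_trans _ th1)//.
  by apply; split.
have rt' : r < t by rewrite lt_neqAle nrt.
have := sewn_estimate th1 K0 rt hX hL (itv_partition1 rt').
by rewrite finer_than_cons rt1 !psum_cons !psum_nil !addr0 => /(_ isT).
Qed.

End Sewing.

(** * Sewing on a half-line with exponentially fading weights *)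

(** The solution of [p = p * exp (- kappa / 2) + (1 + sew_const * exp kappa)]: the sum
    of a geometric series over the past, cut into pieces of length one half. *)
HB.lock Definition prim_const (R : realType) (kappa th : R) : R :=
  (1 + sew_const th * expR kappa) / (1 - expR (- (kappa / 2))).

Section Primitive.
Context {R : realType}.
Variables (T kappa : R).
Hypothesis kappa0 : 0 < kappa.
Implicit Types (Xi : R -> R -> R) (r t u v m C : R).

(** The weight [exp (- kappa (T - u))], where [kappa] will be a positive lower
    bound of the gaps between the rates of [lam] and [rho]. *)
Definition fade u : R := expR (- (kappa * (T - u))).

Lemma fade_gt0 u : 0 < fade u. Proof. exact: expR_gt0. Qed.

Lemma fade_ge0 u : 0 <= fade u. Proof. exact: ltW (fade_gt0 u). Qed.

Lemma fade_le1 u : u <= T -> fade u <= 1.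
Proof.
move=> uT; rewrite -expR0 ler_expR oppr_le0 mulr_ge0 ?subr_ge0//; exact: ltW.
Qed.

Lemma fade_mono u v : u <= v -> fade u <= fade v.
Proof. by move=> uv; rewrite ler_expR lerN2 ler_pM2l// lerD2l lerN2. Qed.

Lemma fade_shift u v : v - u < 1 -> fade v <= expR kappa * fade u.
Proof.
move=> uv; rewrite /fade -expRD ler_expR.
suff : kappa * (v - u) <= kappa * 1 by lra.
by rewrite ler_pM2l// ltW.
Qed.

Lemma fade_to0 eps : 0 < eps -> exists r0, forall r, r <= r0 -> fade r < eps.
Proof.
move=> e0; have e20 : 0 < eps / 2 by rewrite divr_gt0.
exists (T + ln (eps / 2) / kappa) => r hr.
apply: (@le_lt_trans _ _ (eps / 2)); last by lra.
rewrite -[leRHS](@lnK R) ?posrE// ler_expR.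
have : kappa * (r - T) <= kappa * (ln (eps / 2) / kappa) by rewrite ler_pM2l//; lra.
by rewrite (mulrC _ (_ / _)) divfK ?gt_eqF//; lra.
Qed.

Lemma half_fade_lt1 : expR (- (kappa / 2)) < 1.
Proof. by rewrite -expR0 ltr_expR oppr_lt0 divr_gt0. Qed.

Lemma prim_const_ge0 th : 1 < th -> 0 <= prim_const kappa th.
Proof.
move=> th1; rewrite prim_const.unlock; apply: divr_ge0; last by rewrite subr_ge0 ltW// half_fade_lt1.
apply: addr_ge0 => //; apply: mulr_ge0; [exact: sew_const_ge0 | exact: expR_ge0].
Qed.

Lemma prim_constE th :
  prim_const kappa th = prim_const kappa th * expR (- (kappa / 2)) + (1 + sew_const th * expR kappa).
Proof.
have h := half_fade_lt1; rewrite prim_const.unlock; field.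
by rewrite subr_eq0 eq_sym lt_eqF.
Qed.

Lemma prim_const_ge th : 1 < th -> 1 + sew_const th * expR kappa <= prim_const kappa th.
Proof.
move=> th1; rewrite prim_const.unlock ler_pdivlMr ?subr_gt0 ?half_fade_lt1//.
rewrite ler_piMr ?gerBl ?expR_ge0// addr_ge0//.
by apply: mulr_ge0; [exact: sew_const_ge0 | exact: expR_ge0].
Qed.

Lemma sewn_diag r Xi L : sewn Xi r r L -> L = 0.
Proof.
move=> h; have := sewn_add (lexx r) (lexx r) h h h.
by lra.
Qed.

Variables (th : R) (s : \bar R) (Xi : R -> R -> R) (C : R).
Hypotheses (th1 : 1 < th) (C0 : 0 <= C).
Hypothesis Xi_defect : forall u m v, (s <= u%:E)%E -> u <= m -> m <= v -> v <= T ->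
  v - u < 1 -> `|Xi u v - Xi u m - Xi m v| <= C * fade u * (v - u) `^ th.
Hypothesis Xi_bound : forall u v, (s <= u%:E)%E -> u <= v -> v <= T -> v - u < 1 ->
  `|Xi u v| <= C * fade u.

Let dom_mono u v : (s <= u%:E)%E -> u <= v -> (s <= v%:E)%E.
Proof. by move=> su uv; apply: le_trans su _; rewrite lee_fin. Qed.

Lemma Xi_sewable r t : (s <= r%:E)%E -> t <= T -> sewable (C * fade t) th r t Xi.
Proof.
move=> sr tT u m v ru um mv vt vu; have ut : u <= t by lra.
apply: le_trans (Xi_defect _ um mv _ vu) _; [exact: dom_mono ru | exact: le_trans tT|].
by rewrite ler_wpM2r ?powR_ge0// ler_wpM2l// fade_mono.
Qed.

Lemma Xi_sewable_local r t : (s <= r%:E)%E -> r <= t -> t <= T -> t - r < 1 ->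
  sewable (expR kappa * (C * fade r)) th r t Xi.
Proof.
move=> sr rt tT rt1 u m v ru um mv vt vu; have ut : u <= t by lra.
apply: le_trans (Xi_defect _ um mv _ vu) _; [exact: dom_mono ru | exact: le_trans tT|].
rewrite ler_wpM2r ?powR_ge0// mulrCA ler_wpM2l// fade_shift//; lra.
Qed.

Lemma sewn_local_fade u v L : (s <= u%:E)%E -> u <= v -> v <= T -> v - u < 1 ->
  sewn Xi u v L ->
  `|Xi u v - L| <= sew_const th * (expR kappa * (C * fade u)) * (v - u) `^ th.
Proof.
move=> su uv vT uv1; apply: sewn_local => //; last exact: Xi_sewable_local.
by rewrite !mulr_ge0 ?fade_ge0 ?expR_ge0.
Qed.

Lemma sewn_bound_local u v L : (s <= u%:E)%E -> u <= v -> v <= T -> v - u < 1 ->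
  sewn Xi u v L -> `|L| <= C * (1 + sew_const th * expR kappa) * fade u.
Proof.
move=> su uv vT uv1 hL; have h1 := sewn_local_fade su uv vT uv1 hL.
have h2 := Xi_bound su uv vT uv1.
have p1 : (v - u) `^ th <= 1.
  rewrite -(powRr0 (v - u)); have [e|nuv] := eqVneq u v.
    by rewrite e subrr powRr0 powR0 ?gt_eqF// (lt_trans _ th1).
  apply: ger_powR; last exact: ltW (lt_trans ltr01 th1).
  by rewrite subr_gt0 lt_neqAle nuv uv /= ltW.
have := ler_wpM2l (_ : 0 <= sew_const th * (expR kappa * (C * fade u))) p1.
rewrite mulr1 => /(_ _)/wrap[|h3].
  by rewrite !mulr_ge0 ?fade_ge0 ?expR_ge0 ?sew_const_ge0.
have := le_trans h1 h3; move: h2; rewrite !ler_norml => /andP[? ?] /andP[? ?].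
by apply/andP; split; lra.
Qed.

(** The past of [v] is cut into pieces of length one half. Each step back by one
    half gains a factor [exp (- kappa / 2)], so the contributions form a convergent
    geometric series, and the bound does not depend on [u]. *)
Lemma sewn_bound u v L : (s <= u%:E)%E -> u <= v -> v <= T ->
  sewn Xi u v L -> `|L| <= prim_const kappa th * C * fade v.
Proof.
move=> su uv vT; have q1 := half_fade_lt1.
have c0 : 0 <= sew_const th * expR kappa by rewrite mulr_ge0 ?expR_ge0 ?sew_const_ge0.
have [n] : exists n, v - u <= n%:R / 2.
  exists (Num.truncn ((v - u) * 2)).+1; rewrite ler_pdivlMr//; exact/ltW/truncnS_gt.
have base w x L' : (s <= w%:E)%E -> w <= x -> x <= T -> x - w <= 1 / 2 -> 
    sewn Xi w x L' -> `|L'| <= C * (1 + sew_const th * expR kappa) * fade w.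
  by move=> sw wx xT xw; apply: sewn_bound_local => //; lra.
elim: n v uv vT L => [|n IH] v uv vT L h hL.
  have e : u = v by lra.
  move: hL; rewrite e => /sewn_diag ->; rewrite normr0.
  by rewrite !mulr_ge0 ?fade_ge0 ?prim_const_ge0.
have [h1|h1] := leP (v - u) (1 / 2).
  apply: le_trans (base _ _ _ su uv vT h1 hL) _.
  apply: ler_pM; rewrite ?fade_ge0 ?fade_mono ?mulr_ge0 ?addr_ge0//.
  by rewrite [leRHS]mulrC ler_wpM2l// prim_const_ge.
have um : u <= v - 1 / 2 by lra.
have mT : v - 1 / 2 <= T by lra.
have K0 : 0 <= C * fade v by rewrite mulr_ge0 ?fade_ge0.
have [L1 hL1] : exists L1, sewn Xi u (v - 1 / 2) L1.
  by apply: (sewing th1 K0 um); apply: sewable_sub (Xi_sewable su vT) => //; lra.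
have mv : v - 1 / 2 <= v by lra.
have sm := dom_mono su um.
have [L2 hL2] : exists L2, sewn Xi (v - 1 / 2) v L2.
  by apply: (sewing th1 K0 mv); apply: sewable_sub (Xi_sewable su vT) => //; lra.
rewrite (sewn_add um mv hL1 hL2 hL).
have {}IH : `|L1| <= prim_const kappa th * C * fade (v - 1 / 2).
  by apply: IH => //; move: h; rewrite -natr1; lra.
have b2 : `|L2| <= C * (1 + sew_const th * expR kappa) * fade (v - 1 / 2).
  by apply: (base _ _ _ sm mv vT _ hL2); lra.
apply: le_trans (ler_normD _ _) _; apply: le_trans (lerD IH b2) _.
have fE : fade (v - 1 / 2) = expR (- (kappa / 2)) * fade v.
  by rewrite /fade -expRD; congr expR; field.
have -> : prim_const kappa th * C * fade v = prim_const kappa th * C * fade (v - 1 / 2) +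
    C * (1 + sew_const th * expR kappa) * fade v by rewrite fE {1}prim_constE; ring.
by rewrite lerD2l ler_wpM2l ?fade_mono ?mulr_ge0 ?addr_ge0.
Qed.

(** The indefinite integral of a germ from the lower bound [s]. When [s] is
    infinite, the integrals from [r] to [t] are, up to an error proportional to
    [fade r], independent of [r], and the integral from [-oo] is obtained from
    [common_point]. In both cases increments of [z] are integrals, and the bound
    by [fade t] is uniform in [s]. *)
Lemma primitive_exists : exists z : R -> R,
  [/\ forall r t, (s <= r%:E)%E -> r <= t -> t <= T -> sewn Xi r t (z t - z r),
      forall t, (s <= t%:E)%E -> t <= T -> `|z t| <= prim_const kappa th * C * fade t &
      forall r, s = r%:E -> r <= T -> z r = 0].
Proof.
have [|I hI] := @boolp.choice (R * R) R (fun p L =>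
    (s <= p.1%:E)%E -> p.1 <= p.2 -> p.2 <= T -> sewn Xi p.1 p.2 L).
  move=> [r t] /=.
  have [h|nh] := pselect [/\ (s <= r%:E)%E, r <= t & t <= T]; last first.
    by exists 0 => ? ? ?; exfalso; apply: nh.
  have [sr rt tT] := h.
  have [|L hL] := sewing th1 _ rt (Xi_sewable sr tT).
    by rewrite mulr_ge0 ?fade_ge0.
  by exists L.
have Iadd r u t : (s <= r%:E)%E -> r <= u -> u <= t -> t <= T ->
    I (r, t) = I (r, u) + I (u, t).
  move=> sr ru ut tT; have uT := le_trans ut tT; have rt := le_trans ru ut.
  apply: (@sewn_add _ r u t Xi) => //.
  - exact: (hI (r, u)).
  - by apply: (hI (u, t)) => //; exact: dom_mono ru.
  - exact: (hI (r, t)).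
have Ibd r t : (s <= r%:E)%E -> r <= t -> t <= T -> `|I (r, t)| <= prim_const kappa th * C * fade t.
  by move=> sr rt tT; apply: sewn_bound (hI (r, t) _ _ _).
have Itt t : (s <= t%:E)%E -> t <= T -> I (t, t) = 0.
  by move=> st tT; apply: sewn_diag (hI (t, t) _ _ _).
case: s dom_mono hI Iadd Ibd Itt => [r| |] dm hI' Iadd Ibd Itt.
- exists (fun t => I (r, t)); split.
  + move=> r' t sr' r't tT.
    rewrite (Iadd r r' t) ?lexx// addrAC subrr add0r; exact: (hI' (r', t)).
  + by move=> t st tT; apply: Ibd; rewrite ?lexx.
  + by move=> r' [<-] rT; rewrite Itt ?lexx.
- by exists (fun=> 0); split.
have [|z hz] := @boolp.choice R R (fun t y => t <= T -> forall r, r <= t ->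
    `|I (r, t) - y| <= prim_const kappa th * C * fade r).
  move=> t; have [tT|Tt] := leP t T; last by exists 0.
  have [||z hz] := @common_point R _ [set r | r <= t] (fun r => I (r, t))
      (fun r => prim_const kappa th * C * fade r).
  - by exists t; rewrite /= lexx.
  - move=> i j /= it jt; have [ij|ji] := leP i j.
      have := Ibd i j (leNye _) ij (le_trans jt tT).
      have := fade_mono ij; rewrite (Iadd i j t) ?leNye//.
      have : 0 <= prim_const kappa th * C * fade i.
        by rewrite !mulr_ge0 ?fade_ge0 ?prim_const_ge0.
      by rewrite !ler_norml => ? ? /andP[? ?]; lra.
    have := Ibd j i (leNye _) (ltW ji) (le_trans it tT).
    rewrite (Iadd j i t) ?leNye ?(ltW ji)//.
    have : 0 <= prim_const kappa th * C * fade j.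
      by rewrite !mulr_ge0 ?fade_ge0 ?prim_const_ge0.
    by rewrite !ler_norml => ? /andP[? ?]; lra.
  by exists z => _ r rt; exact: hz.
exists z; split => //.
- move=> r t _ rt tT; suff -> : z t - z r = I (r, t) by exact: (hI' (r, t) (leNye _)).
  apply/eqP; rewrite -subr_eq0 -normr_le0 leNgt; apply/negP => e0.
  have A0 : 0 < 2 * (prim_const kappa th * C) + 1.
    by rewrite ltr_wpDl// !mulr_ge0 ?prim_const_ge0.
  have [r0 hr0] := fade_to0 (divr_gt0 e0 A0).
  pose q := Num.min r0 r.
  have qr : q <= r by rewrite ge_min lexx orbT.
  have := hr0 q; rewrite ge_min lexx => /(_ isT); rewrite ltr_pdivlMr//.
  have := hz t tT q (le_trans qr rt); have := hz r (le_trans rt tT) q qr.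
  rewrite (Iadd q r t) ?leNye//.
  have := fade_ge0 q; move: e0.
  set a := z t - z r - I (r, t); set f := fade q; set B := prim_const kappa th * C => e0 f0.
  rewrite !ler_norml => /andP[? ?] /andP[? ?].
  have : `|a| <= 2 * (B * f) by rewrite ler_norml /a; apply/andP; split; lra.
  by move: e0; lra.
- move=> t _ tT; have := hz t tT t (lexx t).
  by rewrite Itt ?leNye// sub0r normrN.
Qed.

End Primitive.

(** * Tensors, damping operators and convergence of coefficients *)

Section TensorAlgebra.
Context {R : realType} {d : nat}.
Implicit Types (mu : 'rV[R]_d) (h u v r t : R).

Lemma wordsum_split n m p (e : (n + m)%N = p) mu (w : word d p) :
  wordsum mu w = wordsum mu [ffun i => w (cast_ord e (lshift m i))] +
                 wordsum mu [ffun j => w (cast_ord e (rshift n j))].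
Proof.
case: p / e w => w; rewrite /wordsum big_split_ord.
by congr (_ + _); apply: eq_bigr => i _; rewrite ffunE cast_ord_id.
Qed.

Lemma tensorBE n (A B : tensor R d n) w : (A - B) w = A w - B w.
Proof. by rewrite !ffunE. Qed.

Lemma Dop_tmul n m p (e : (n + m)%N = p) mu h (A : tensor R d n) (B : tensor R d m) :
  Dop mu h (tmul e A B) = tmul e (Dop mu h A) (Dop mu h B).
Proof.
apply/ffunP => w; rewrite !ffunE (wordsum_split e) mulrDl opprD expRD.
by rewrite -!mulrA; congr (_ * _); rewrite mulrCA.
Qed.

Lemma DopD mu h n (A B : tensor R d n) : Dop mu h (A + B) = Dop mu h A + Dop mu h B.
Proof. by apply/ffunP => w; rewrite !ffunE mulrDr. Qed.

Lemma Dop0 mu h n : Dop mu h (0 : tensor R d n) = 0.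
Proof. by apply/ffunP => w; rewrite !ffunE mulr0. Qed.

Lemma DopDop mu h k n (A : tensor R d n) : Dop mu h (Dop mu k A) = Dop mu (h + k) A.
Proof. by apply/ffunP => w; rewrite !ffunE mulrA -expRD -opprD -mulrDr. Qed.

(** The summand of a rough Riemann sum once the damping has been absorbed in its
    four arguments. *)
Definition germ n (z : tensor R d n) (z' : tensor R d n.-1)
    (a : tensor R d 1) (b : tensor R d 2) : tensor R d n.+1 :=
  tmul (addn1 n) z a + tmul2 z' b.

Lemma Dop_germ mu h n (z : tensor R d n) z' a b :
  Dop mu h (germ z z' a b) = germ (Dop mu h z) (Dop mu h z') (Dop mu h a) (Dop mu h b).
Proof.
rewrite /germ DopD Dop_tmul; congr (_ + _).
by case: n z z' => [|n] z z' /=; rewrite ?Dop0 ?Dop_tmul.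
Qed.

(** Damping by [- u] multiplies the coefficient of [w] by [exp (mu^w u)]. As the damping
    of a product is the product of the dampings, this removes the factor
    [exp (- mu^w (t - u))] from the rough sums up to a constant factor; the price is
    that [nlev1] is no longer exactly additive. *)
Definition nlev1 mu (X : two_level R d) u v := Dop mu (- u) (lev1 X u v).
Definition nlev2 mu (X : two_level R d) u v := Dop mu (- u) (lev2 X u v).

Definition ngerm mu (X : two_level R d) n (Y : R -> tensor R d n)
    (Y' : R -> tensor R d n.-1) (w : word d n.+1) u v : R :=
  germ (Dop mu (- u) (Y u)) (Dop mu (- u) (Y' u)) (nlev1 mu X u v) (nlev2 mu X u v) w.

Lemma rough_sumE mu X n Y Y' r t P (w : word d n.+1) :
  rough_sum mu X Y Y' r t P w =
  expR (- (wordsum mu w * t)) * psum (ngerm mu X Y Y' w) r P.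
Proof.
rewrite /rough_sum sum_ffunE /psum mulr_sumr; apply: eq_bigr => -[u v] _ /=.
rewrite /ngerm -Dop_germ !ffunE /= mulrA -expRD; congr (expR _ * _).
by ring.
Qed.

Lemma tnorm_ge n (A : tensor R d n) w : `|A w| <= tnorm A.
Proof.
rewrite -sqrtr_sqr ler_wsqrtr// (bigD1 w)//= lerDl.
by apply: sumr_ge0 => i _; exact: sqr_ge0.
Qed.

Lemma cvg_sumr (I J : Type) (F : set_system I) (FF : Filter F) (P : seq J)
    (f : J -> I -> R) (l : J -> R) : (forall j, f j x @[x --> F] --> l j) ->
  (\sum_(j <- P) f j x) @[x --> F] --> \sum_(j <- P) l j.
Proof.
move=> h; elim: P => [|j P IH].
  by rewrite big_nil; under eq_fun do rewrite big_nil; exact: cvg_cst.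
by rewrite big_cons; under eq_fun do rewrite big_cons; exact: cvgD.
Qed.

(** All limits of tensors are reduced to limits of coefficients. *)
Lemma tnorm_cvg0P (I : Type) (F : set_system I) (FF : Filter F) n
    (f : I -> tensor R d n) (L : tensor R d n) :
  tnorm (f x - L) @[x --> F] --> (0 : R) <-> forall w, f x w @[x --> F] --> L w.
Proof.
split=> [h w|h].
  apply/cvgrPdist_lt => e e0; move/cvgrPdist_lt: h => /(_ _ e0).
  apply: filterS => x; rewrite sub0r normrN => hx; rewrite distrC.
  apply: le_lt_trans hx; apply: le_trans (ler_norm _).
  by have := tnorm_ge (f x - L) w; rewrite !ffunE.
have hs : (\sum_w (f x w - L w) ^+ 2) @[x --> F] --> (\sum_(w : word d n) (0 : R)).
  apply: cvg_sumr => w; rewrite -(mulr0 0).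
  have hw : f x w - L w @[x --> F] --> (0 : R).
    by rewrite -(subrr (L w)); apply: cvgB; [exact: h | exact: cvg_cst].
  exact: cvgM.
rewrite big1 in hs => //.
rewrite -(@sqrtr0 R).
have -> : (fun x => tnorm (f x - L)) = (fun x => Num.sqrt (\sum_w (f x w - L w) ^+ 2)).
  apply/funext => x; rewrite /tnorm; congr Num.sqrt; apply: eq_bigr => w _.
  by rewrite !ffunE.
by apply: continuous_cvg => //; exact: sqrt_continuous.
Qed.

Lemma tlimE (I : Type) (F : set_system I) (FF : ProperFilter F) n
    (f : I -> tensor R d n) (L : tensor R d n) :
  (forall w, f x w @[x --> F] --> L w) -> tlim F f = L.
Proof.
move=> h; rewrite /tlim; case: xgetP => [L' -> /tnorm_cvg0P hL'|/(_ L)].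
  apply/ffunP => w; exact: (cvg_unique _ (hL' w) (h w)).
by move=> n0; exfalso; apply: n0; apply/tnorm_cvg0P.
Qed.

Lemma mesh_to0_proper r t : r <= t -> ProperFilter (mesh_to0 r t).
Proof.
move=> rt; apply: filter_from_proper; last first.
  move=> e /= e0; have [P hP fP] := finer_partition_exists e0 rt.
  by exists P; split => //; exact: finer_than_mesh.
apply: filter_from_filter; first by exists 1 => /=.
move=> e f /= e0 f0; exists (Num.min e f); first by rewrite /= lt_min e0.
by move=> P /= [hP]; rewrite lt_min => /andP[? ?].
Qed.

Lemma sewn_mesh_to0 (Xi : R -> R -> R) r t L : r <= t ->
  sewn Xi r t L -> psum Xi r P @[P --> mesh_to0 r t] --> L.
Proof.
move=> rt h; have FF := mesh_to0_proper rt; apply/cvgrPdist_lt => e e0.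
have [D D0 hD] := h _ e0; exists D => // P [hP /mesh_finer_than fP].
by rewrite distrC; exact: hD.
Qed.

Lemma rough_conv_finE mu X n Y Y' r t (I : word d n.+1 -> R) : r <= t ->
  (forall w, sewn (ngerm mu X Y Y' w) r t (I w)) ->
  rough_conv_fin mu X Y Y' r t = Dop mu t [ffun w => I w].
Proof.
move=> rt h; have FF := mesh_to0_proper rt; apply: tlimE => w.
rewrite !ffunE; under eq_fun do rewrite rough_sumE.
by apply: cvgM; [exact: cvg_cst | exact: sewn_mesh_to0].
Qed.

(** The bridge from limits in the sense of [tlim] to indefinite integrals of germs. *)
Lemma rough_convE mu X n Y Y' (T : R) (s : \bar R) (z : word d n.+1 -> R -> R) :
  (forall w r t, (s <= r%:E)%E -> r <= t -> t <= T ->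
     sewn (ngerm mu X Y Y' w) r t (z w t - z w r)) ->
  (forall w r, s = r%:E -> r <= T -> z w r = 0) ->
  (s = -oo%E -> forall w eps, 0 < eps -> exists r0, forall r, r <= r0 -> `|z w r| < eps) ->
  forall t, (s <= t%:E)%E -> t <= T ->
  rough_conv mu X Y Y' s t = Dop mu t [ffun w => z w t].
Proof.
case: s => [r| |] h h0 hoo t st tT //=.
  have rt : r <= t by rewrite lee_fin in st.
  rewrite (rough_conv_finE (I := fun w => z w t)) => // w.
  by have := h w r t (lexx _) rt tT; rewrite (h0 w r) ?subr0// (le_trans rt tT).
apply: tlimE => w; apply/cvgrPdist_lt => e e0.
have [r0 hr0] := hoo erefl w (e * expR (wordsum mu w * t)) (mulr_gt0 e0 (expR_gt0 _)).
exists (Num.min r0 t); split; first exact: num_real.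
move=> r /=; rewrite lt_min => /andP[/ltW rr0 /ltW rt].
rewrite (rough_conv_finE (I := fun w => z w t - z w r)) => //; last first.
  by move=> w'; apply: h => //; exact: leNye.
rewrite !ffunE -mulrBr subKr normrM gtr0_norm ?expR_gt0//.
by rewrite expRN mulrC ltr_pdivrMr ?expR_gt0// hr0.
Qed.

End TensorAlgebra.

(** * Elementary estimates *)

Section Powers.
Context {R : realType}.
Implicit Types h x y : R.

(** The exponents are positive because the base may be zero, and [0] to the power
    [0] is [1]. *)
Lemma powR_le_exp h x y : 0 <= h <= 1 -> 0 < y <= x -> h `^ x <= h `^ y.
Proof.
move=> /andP[h0 h1] /andP[y0 yx]; have x0 := lt_le_trans y0 yx.
have [->|hn] := eqVneq h 0; first by rewrite !powR0 ?gt_eqF.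
by apply: ger_powR => //; rewrite lt_neqAle eq_sym hn h0.
Qed.

Lemma powR_mulD h x y : 0 < x -> 0 < y -> h `^ x * h `^ y = h `^ (x + y).
Proof. by move=> x0 y0; rewrite powRD// gt_eqF// addr_gt0. Qed.

Lemma powR_le_base h k x : 0 <= h <= k -> 0 <= x -> h `^ x <= k `^ x.
Proof.
move=> /andP[h0 hk] x0; apply: ge0_ler_powR => //; rewrite nnegrE//.
exact: le_trans hk.
Qed.

Lemma mul_powR_le h x y : 0 <= h <= 1 -> 0 < y -> 0 < x -> y <= 1 + x -> h * h `^ x <= h `^ y.
Proof.
move=> h01 y0 x0 yx; have /andP[h0 h1] := h01.
rewrite -{1}[h]powRr1// powR_mulD//; apply: powR_le_exp => //; exact/andP.
Qed.

Lemma expR_decr_bound x : 0 <= x -> `|expR (- x) - 1| <= x.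
Proof.
move=> x0; have h := expR_ge1Dx (- x).
have h1 : expR (- x) <= 1 by rewrite -expR0 ler_expR oppr_le0.
by rewrite ler_norml; apply/andP; split; lra.
Qed.

Lemma finite_upper_bound (J : finType) (f : J -> R) : exists2 L, 0 <= L & forall j, f j <= L.
Proof.
exists (\sum_j `|f j|) => [|j]; first exact: sumr_ge0.
rewrite (bigD1 j)//= (le_trans (ler_norm _))// lerDl; exact: sumr_ge0.
Qed.

Lemma finite_positive_lower_bound (J : finType) (f : J -> R) : (forall j, 0 < f j) ->
  exists2 k, 0 < k & forall j, k <= f j.
Proof.
move=> f0; have [L L0 hL] := finite_upper_bound (fun j => (f j)^-1).
exists (L + 1)^-1 => [|j]; first by rewrite invr_gt0 ltr_wpDl.
rewrite -[leRHS]invrK lef_pV2 ?posrE ?invr_gt0// ?ltr_wpDl//.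
by apply: le_trans (hL j) _; rewrite lerDl.
Qed.

End Powers.

(** * Coefficientwise bounds on tensors *)

Section TensorBounds.
Context {R : realType} {d : nat}.

Definition tbound n (A : tensor R d n) (c : R) := forall w, `|A w| <= c.

Lemma tboundW n (A : tensor R d n) c c' : c <= c' -> tbound A c -> tbound A c'.
Proof. by move=> cc h w; exact: le_trans cc. Qed.

Lemma tbound0 n c : 0 <= c -> tbound (0 : tensor R d n) c.
Proof. by move=> c0 w; rewrite ffunE normr0. Qed.

Lemma tboundD n (A B : tensor R d n) c c' :
  tbound A c -> tbound B c' -> tbound (A + B) (c + c').
Proof. by move=> hA hB w; rewrite ffunE (le_trans (ler_normD _ _))// lerD. Qed.

Lemma tboundN n (A : tensor R d n) c : tbound A c -> tbound (- A) c.
Proof. by move=> hA w; rewrite ffunE normrN. Qed.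

Lemma tboundB n (A B : tensor R d n) c c' :
  tbound A c -> tbound B c' -> tbound (A - B) (c + c').
Proof. by move=> hA hB; apply: tboundD => //; exact: tboundN. Qed.

Lemma tbound_tmul n m p (e : (n + m)%N = p) (A : tensor R d n) (B : tensor R d m) c c' :
  tbound A c -> tbound B c' -> tbound (tmul e A B) (c * c').
Proof. by move=> hA hB w; rewrite ffunE normrM ler_pM. Qed.

Lemma tbound_tmul2 n (A : tensor R d n.-1) (B : tensor R d 2) c c' :
  0 <= c -> 0 <= c' -> tbound A c -> tbound B c' -> tbound (tmul2 A B) (c * c').
Proof.
case: n A => [|n] A c0 c0' hA hB /=; first by apply: tbound0; rewrite mulr_ge0.
exact: tbound_tmul.
Qed.

End TensorBounds.

(** * Undamped rough paths are almost rough paths *)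

Section RoughPathBounds.
Context {R : realType} {d : nat}.
Variables (T alpha : R) (lam rho : 'rV[R]_d).
Hypotheses (alpha0 : 0 < alpha) (alpha_half : alpha <= 2^-1).
Hypothesis lam_rho : forall i, 0 < rho 0 i < lam 0 i.

(** A bound [M] on the weighted seminorm, read on coefficients and solved for
    the coefficient. *)
Definition level_bounded n (beta M : R) (A : R -> R -> tensor R d n) :=
  forall u v w, u < v -> v <= T -> v - u < 1 ->
  `|A u v w| <= M * expR (wordsum rho w * (T - u)) * (v - u) `^ beta.

Definition bounded_rough (M : R) (X : two_level R d) : Prop :=
  [/\ rough_path T alpha rho X, level_bounded alpha M (lev1 X) &
      level_bounded (2 * alpha) M (lev2 X)].

Lemma wnorm_level_bounded n beta M (A : R -> R -> tensor R d n) :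
  (wnorm T rho beta A <= M%:E)%E -> level_bounded beta M A.
Proof.
move=> h u v w uv vT uv1.
have h1 : ((tnorm (Dop rho (T - u) (A u v)) / `|v - u| `^ beta)%:E <= M%:E)%E.
  by apply: le_trans h; apply: ereal_sup_ubound; exists u, v.
have p0 : 0 < (v - u) `^ beta by rewrite powR_gt0// subr_gt0.
move: h1; rewrite lee_fin gtr0_norm ?subr_gt0// ler_pdivrMr// => h1.
have := le_trans (tnorm_ge (Dop rho (T - u) (A u v)) w) h1.
rewrite ffunE normrM gtr0_norm ?expR_gt0// expRN ler_pdivrMl ?expR_gt0//.
by rewrite mulrCA mulrA.
Qed.

Lemma wnorm_ge0 n beta (A : R -> R -> tensor R d n) : (0 <= wnorm T rho beta A)%E.
Proof.
apply: le_trans (_ : (tnorm (Dop rho (T - (T - 2^-1)) (A (T - 2^-1) T)) /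
    `|T - (T - 2^-1)| `^ beta)%:E <= _)%E.
  by rewrite lee_fin divr_ge0 ?powR_ge0 ?sqrtr_ge0.
by apply: ereal_sup_ubound; exists (T - 2^-1), T; split => //; lra.
Qed.

Lemma wnorm_finite n beta (A : R -> R -> tensor R d n) :
  (wnorm T rho beta A < +oo)%E -> exists2 M, 0 <= M & level_bounded beta M A.
Proof.
have := wnorm_ge0 beta A; case E : (wnorm _ _ _ _) => [M| |] // M0 _.
exists M => //; by apply: wnorm_level_bounded; rewrite E.
Qed.

Lemma rough_dist_level_bounded X Y (del : R) :
  (rough_dist T alpha rho X Y < del%:E)%E ->
  level_bounded alpha del (fun u v => lev1 X u v - lev1 Y u v) /\
  level_bounded (2 * alpha) del (fun u v => lev2 X u v - lev2 Y u v).
Proof.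
rewrite /rough_dist; set A := fun s t => lev1 X s t - _; set B := fun s t => lev2 X s t - _.
move=> h; have a0 := wnorm_ge0 alpha A; have b0 := wnorm_ge0 (2 * alpha) B.
split; apply: wnorm_level_bounded; apply: le_trans (ltW h).
  exact: leeDl.
exact: leeDr.
Qed.

Lemma level_boundedD n beta M M' (A B : R -> R -> tensor R d n) :
  level_bounded beta M A -> level_bounded beta M' (fun u v => A u v - B u v) ->
  level_bounded beta (M + M') B.
Proof.
move=> hA hB u v w uv vT uv1.
have := hA u v w uv vT uv1; have := hB u v w uv vT uv1; rewrite !ffunE.
rewrite !mulrDl !ler_norml => /andP[? ?] /andP[? ?]; apply/andP; split; lra.
Qed.

Lemma level_boundedW n beta M M' (A : R -> R -> tensor R d n) :
  M <= M' -> level_bounded beta M A -> level_bounded beta M' A.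
Proof.
move=> MM h u v w uv vT uv1; apply: le_trans (h u v w uv vT uv1) _.
by rewrite -!mulrA ler_wpM2r// mulr_ge0 ?expR_ge0 ?powR_ge0.
Qed.

(** Every estimate below is uniform over the rough paths with a given bound, and
    hence over a ball. *)
Lemma ball_bounded X : rough_path T alpha rho X -> exists M, [/\ 0 <= M, bounded_rough M X &
  forall Y, rough_path T alpha rho Y -> (rough_dist T alpha rho X Y < 1%:E)%E ->
    bounded_rough M Y].
Proof.
move=> hX; have [_ w1 w2 _] := hX.
have [M1 M10 h1] := wnorm_finite w1; have [M2 M20 h2] := wnorm_finite w2.
exists (M1 + M2 + 1); split.
- by rewrite !addr_ge0.
- by split => //; [apply: level_boundedW h1|apply: level_boundedW h2]; lra.
move=> Y hY hXY; have [b1 b2] := rough_dist_level_bounded hXY; split => //.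
  by apply: level_boundedW (level_boundedD h1 b1); lra.
by apply: level_boundedW (level_boundedD h2 b2); lra.
Qed.

Lemma lev1_add X : rough_path T alpha rho X -> forall u m v, u <= m -> m <= v -> v <= T ->
  lev1 X u v = lev1 X u m + lev1 X m v.
Proof.
move=> [[x hx] _ _ _] u m v um mv vT.
rewrite !hx ?(le_trans um mv) ?(le_trans mv vT)//.
by rewrite [RHS]addrC addrA subrK.
Qed.

Lemma lev1_diag X u : rough_path T alpha rho X -> u <= T -> lev1 X u u = 0.
Proof. by move=> [[x hx] _ _ _] uT; rewrite hx ?subrr. Qed.

Lemma lev2_diag X u : rough_path T alpha rho X -> u <= T -> lev2 X u u = 0.
Proof.
move=> hX uT; have [_ _ _ /(_ u u u (lexx _) (lexx _) uT)] := hX.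
rewrite (lev1_diag hX uT) => h; apply/ffunP => w.
move/ffunP/(_ w): h; rewrite !ffunE mul0r addr0 => h.
by lra.
Qed.

(** Additivity and Chen's identity up to errors of order [3 alpha > 1], with bounds that
    fade in the past. Such errors do not affect the sewing of germs. *)
Definition almost_rough (kappa c : R) (a : R -> R -> tensor R d 1) (b : R -> R -> tensor R d 2) :=
  forall u m v, u <= m -> m <= v -> v <= T -> v - u < 1 ->
  [/\ tbound (a u v) (c * fade T kappa u * (v - u) `^ alpha),
      tbound (b u v) (c * fade T kappa u * (v - u) `^ (2 * alpha)),
      tbound (a u v - a u m - a m v) (c * fade T kappa u * (v - u) `^ (3 * alpha)) &
      tbound (b u v - b u m - b m v - tmul (erefl : (1 + 1 = 2)%N) (a u m) (a m v))
        (c * fade T kappa u * (v - u) `^ (3 * alpha))].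

Lemma wordsum_ge0 (mu : 'rV[R]_d) n (w : word d n) : (forall i, 0 <= mu 0 i) ->
  0 <= wordsum mu w.
Proof. by move=> h; apply: sumr_ge0. Qed.

(** Undamping costs [exp (lam^w u)] while the seminorm gives [exp (rho^w (T - u))];
    their product is [exp (lam^w T)] times [exp (- (lam^w - rho^w)(T - u))], and the
    last factor is at most [fade u] because [w] has at least one letter. *)
Lemma nlev_bound n beta M L kappa (A : R -> R -> tensor R d n.+1) :
  0 < beta -> 0 <= M ->
  0 < kappa -> (forall i, kappa <= lam 0 i - rho 0 i) ->
  (forall w : word d n.+1, expR (wordsum lam w * T) <= L) ->
  level_bounded beta M A -> (forall u, u <= T -> A u u = 0) ->
  forall u v, u <= v -> v <= T -> v - u < 1 ->
  tbound (Dop lam (- u) (A u v)) (M * L * fade T kappa u * (v - u) `^ beta).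
Proof.
move=> beta0 M0 k0 hk hL hA hd u v uv vT uv1 w.
have [e|nuv] := eqVneq u v.
  rewrite -e hd ?Dop0 ?ffunE ?normr0; last by rewrite e.
  by rewrite subrr powR0 ?mulr0// gt_eqF.
have luv : u < v by rewrite lt_neqAle nuv.
rewrite ffunE normrM gtr0_norm ?expR_gt0// mulrN opprK.
have := ler_wpM2l (expR_ge0 (wordsum lam w * u)) (hA u v w luv vT uv1).
move=> h; apply: le_trans h _.
rewrite mulrA ler_wpM2r ?powR_ge0// -!mulrA mulrCA ler_wpM2l//.
rewrite -expRD.
have -> : wordsum lam w * u + wordsum rho w * (T - u) =
  wordsum lam w * T - (wordsum lam w - wordsum rho w) * (T - u) by ring.
rewrite expRD; apply: ler_pM; rewrite ?expR_ge0//.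
rewrite ler_expR lerN2; apply: ler_wpM2r; first by rewrite subr_ge0; lra.
rewrite -sumrB big_ord_recl; apply: le_trans (hk (w ord0)) _; rewrite lerDl.
apply: sumr_ge0 => i _; exact: le_trans (ltW k0) (hk _).
Qed.

(** Additivity and Chen's identity fail after undamping only because the factor
    [exp (lam^w u)] moves between [u] and [m]. It moves by a relative amount of order
    [m - u], which multiplies increments of order [alpha] or [2 alpha]; as [1 + alpha] is
    at least [3 alpha], the error is of the order required. *)
Lemma rough_path_almost_rough kappa M : 0 < kappa -> 0 <= M ->
  (forall i, kappa <= lam 0 i - rho 0 i) ->
  exists2 c, 0 <= c & forall X, bounded_rough M X ->
    almost_rough kappa c (nlev1 lam X) (nlev2 lam X).
Proof.
move=> k0 M0 hk.
have [L L0 hL] : exists2 L, 0 <= L &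
    (forall w : word d 1, expR (wordsum lam w * T) <= L) /\
    (forall w : word d 2, expR (wordsum lam w * T) <= L).
  have [L1 L10 hL1] := finite_upper_bound (fun w : word d 1 => expR (wordsum lam w * T)).
  have [L2 L20 hL2] := finite_upper_bound (fun w : word d 2 => expR (wordsum lam w * T)).
  exists (L1 + L2); first exact: addr_ge0.
  by split => w; [apply: le_trans (hL1 w) _; rewrite lerDl|
                  apply: le_trans (hL2 w) _; rewrite lerDr].
have [B B0 [hB1 hB2]] : exists2 B, 0 <= B &
    (forall w : word d 1, wordsum lam w <= B) /\ (forall w : word d 2, wordsum lam w <= B).
  have [B1 B10 hB1] := finite_upper_bound (fun w : word d 1 => wordsum lam w).
  have [B2 B20 hB2] := finite_upper_bound (fun w : word d 2 => wordsum lam w).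
  exists (B1 + B2); first exact: addr_ge0.
  by split => w; [apply: le_trans (hB1 w) _; rewrite lerDl|
                  apply: le_trans (hB2 w) _; rewrite lerDr].
have [c1 c10 c1E] : exists2 c1, 0 <= c1 & c1 = M * L by exists (M * L); rewrite ?mulr_ge0.
have [E E0 EE] : exists2 E, 0 <= E & E = expR kappa by exists (expR kappa); rewrite ?expR_ge0.
have lam0 i : 0 <= lam 0 i by have /andP[? ?] := lam_rho i; lra.
have Q1 : 0 <= B * c1 * E by rewrite !mulr_ge0.
have Q2 : 0 <= B * c1 * c1 by rewrite !mulr_ge0.
exists (c1 + B * c1 * E + B * c1 * c1); first by rewrite !addr_ge0.
move=> X [hX hX1 hX2].
have bd1 u v : u <= v -> v <= T -> v - u < 1 ->
    tbound (nlev1 lam X u v) (c1 * fade T kappa u * (v - u) `^ alpha).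
  rewrite c1E; apply: nlev_bound => //; first exact: (proj1 hL).
  by move=> u' u'T; exact: (lev1_diag hX).
have bd2 u v : u <= v -> v <= T -> v - u < 1 ->
    tbound (nlev2 lam X u v) (c1 * fade T kappa u * (v - u) `^ (2 * alpha)).
  rewrite c1E; apply: nlev_bound => //; [by rewrite mulr_gt0|exact: (proj2 hL)|].
  by move=> u' u'T; exact: (lev2_diag hX).
have small n (w : word d n) (h : R) : wordsum lam w <= B -> 0 <= h ->
    `|expR (- (wordsum lam w * h)) - 1| <= B * h.
  move=> wB h0; have w0 : 0 <= wordsum lam w by exact: wordsum_ge0.
  apply: le_trans (expR_decr_bound _) _; first exact: mulr_ge0.
  by rewrite ler_wpM2r.
move=> u m v um mv vT uv1.
have uv := le_trans um mv; have mT := le_trans mv vT; have uT := le_trans um mT.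
have mu1 : m - u < 1 by lra.
have vm1 : v - m < 1 by lra.
have h01 : 0 <= v - u <= 1 by apply/andP; split; lra.
have f0 := fade_ge0 T kappa u; have fm0 := fade_ge0 T kappa m.
have fm1 := fade_le1 k0 mT.
have fmu : fade T kappa m <= E * fade T kappa u by rewrite EE; exact: fade_shift.
have P3 : (v - u) * (v - u) `^ alpha <= (v - u) `^ (3 * alpha).
  by apply: mul_powR_le => //; move: alpha0 alpha_half => *; lra.
have P4 : (v - u) * (v - u) `^ (2 * alpha) <= (v - u) `^ (3 * alpha).
  by apply: mul_powR_le => //; move: alpha0 alpha_half => *; lra.
have sub_le (beta x : R) : 0 < beta -> 0 <= x -> x <= v - u -> x `^ beta <= (v - u) `^ beta.
  by move=> b0 x0 xh; apply: powR_le_base; rewrite ?x0// ltW.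
have a20 : 0 < 2 * alpha by rewrite mulr_gt0.
have p3 := powR_ge0 (v - u) (3 * alpha).
have wt x y : 0 <= x -> x <= y -> x * fade T kappa u * (v - u) `^ (3 * alpha) <=
    y * fade T kappa u * (v - u) `^ (3 * alpha).
  by move=> x0 xy; rewrite -!mulrA ler_wpM2r// mulr_ge0.
have drift n (w : word d n) (beta y : R) : wordsum lam w <= B -> 0 < beta ->
    (v - u) * (v - u) `^ beta <= (v - u) `^ (3 * alpha) ->
    `|y| <= c1 * fade T kappa m * (v - m) `^ beta ->
    `|(expR (- (wordsum lam w * (m - u))) - 1) * y| <=
      B * c1 * E * fade T kappa u * (v - u) `^ (3 * alpha).
  move=> wB b0 P hy; rewrite normrM.
  have s1 := small n w (m - u) wB; rewrite subr_ge0 in s1.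
  apply: le_trans (ler_pM _ _ (s1 um) hy) _ => //.
  apply: (@le_trans _ _ (B * (v - u) * (c1 * (E * fade T kappa u) * (v - u) `^ beta))).
    apply: ler_pM; rewrite ?mulr_ge0 ?powR_ge0 ?subr_ge0//.
      by rewrite ler_wpM2l//; lra.
    apply: ler_pM; rewrite ?mulr_ge0 ?powR_ge0 ?ler_wpM2l//.
    by apply: sub_le => //; lra.
  have := ler_wpM2l (_ : 0 <= B * c1 * E * fade T kappa u) P.
  rewrite !mulr_ge0// => /(_ isT); apply: le_trans.
  by rewrite le_eqVlt; apply/orP; left; apply/eqP; ring.
split.
- apply: tboundW (bd1 u v uv vT uv1).
  by rewrite -!mulrA ler_wpM2r ?mulr_ge0 ?powR_ge0//; lra.
- apply: tboundW (bd2 u v uv vT uv1).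
  by rewrite -!mulrA ler_wpM2r ?mulr_ge0 ?powR_ge0//; lra.
- move=> w.
  have -> : (nlev1 lam X u v - nlev1 lam X u m - nlev1 lam X m v) w =
      (expR (- (wordsum lam w * (m - u))) - 1) * nlev1 lam X m v w.
    rewrite /nlev1 (lev1_add hX um mv vT) !ffunE.
    have -> : - (wordsum lam w * - u) = - (wordsum lam w * (m - u)) + - (wordsum lam w * - m).
      by ring.
    by rewrite expRD; ring.
  have wB : wordsum lam w <= B by exact: hB1.
  apply: le_trans (drift _ w alpha _ wB alpha0 P3 (bd1 m v mv vT vm1 w)) _.
  by apply: wt => //; lra.
move=> w.
set w1 : word d 1 := [ffun i => w (cast_ord (erefl : (1 + 1 = 2)%N) (lshift 1 i))].
set w2 : word d 1 := [ffun j => w (cast_ord (erefl : (1 + 1 = 2)%N) (rshift 1 j))].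
have -> : (nlev2 lam X u v - nlev2 lam X u m - nlev2 lam X m v -
    tmul (erefl : (1 + 1 = 2)%N) (nlev1 lam X u m) (nlev1 lam X m v)) w =
    (expR (- (wordsum lam w * (m - u))) - 1) * nlev2 lam X m v w +
    (expR (- (wordsum lam w2 * (m - u))) - 1) * nlev1 lam X m v w2 * nlev1 lam X u m w1.
  rewrite /nlev1 /nlev2; have [_ _ _ /(_ u m v um mv vT) ->] := hX.
  rewrite !ffunE -/w1 -/w2.
  have -> : - (wordsum lam w * - u) = - (wordsum lam w * (m - u)) + - (wordsum lam w * - m).
    by ring.
  have E1 : - (wordsum lam w * (m - u)) + - (wordsum lam w * - m) =
      - (wordsum lam w1 * - u) + (- (wordsum lam w2 * (m - u)) + - (wordsum lam w2 * - m)).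
    by rewrite (wordsum_split (erefl : (1 + 1 = 2)%N) lam w) -/w1 -/w2; ring.
  have E2 : expR (- (wordsum lam w * (m - u))) * expR (- (wordsum lam w * - m)) =
      expR (- (wordsum lam w1 * - u)) * expR (- (wordsum lam w2 * (m - u))) *
      expR (- (wordsum lam w2 * - m)) by rewrite -!expRD E1 addrA.
  rewrite expRD; move: E2.
  set p := expR (- (_ * _)); set q := expR (- (_ * - m)).
  set p1 := expR (- (_ * - u)); set p2 := expR (- (_ * (m - u))).
  set q2 := expR (- (wordsum lam w2 * - m)) => E2.
  set x := lev2 X m v w; set y := lev2 X u m w; set l := lev1 _ _ _ _; set l' := lev1 _ _ _ _.
  (* the first summand vanishes by [E2], and isolating it makes the rest an
     identity of rings *)
  transitivity ((p * q - p1 * p2 * q2) * (l * l') +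
    ((p - 1) * (q * x) + (p2 - 1) * (q2 * l') * (p1 * l))); first by ring.
  by rewrite E2 subrr mul0r add0r.
have wB : wordsum lam w <= B by exact: hB2.
have w2B : wordsum lam w2 <= B by exact: hB1.
have D1 := drift _ w _ _ wB a20 P4 (bd2 m v mv vT vm1 w).
have D2 : `|(expR (- (wordsum lam w2 * (m - u))) - 1) * nlev1 lam X m v w2 * nlev1 lam X u m w1|
   <= B * c1 * c1 * fade T kappa u * (v - u) `^ (3 * alpha).
  rewrite !normrM.
  have s1 := small _ w2 (m - u) w2B; rewrite subr_ge0 in s1.
  have X1 : `|nlev1 lam X m v w2| <= c1 * (v - u) `^ alpha.
    apply: le_trans (bd1 m v mv vT vm1 w2) _; rewrite -mulrA ler_wpM2l//.
    by rewrite -[leRHS]mul1r; apply: ler_pM => //; [exact: powR_ge0|apply: sub_le => //; lra].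
  have X2 : `|nlev1 lam X u m w1| <= c1 * fade T kappa u * (v - u) `^ alpha.
    apply: le_trans (bd1 u m um mT mu1 w1) _; rewrite ler_wpM2l ?mulr_ge0//.
    by apply: sub_le => //; lra.
  have X3 : `|expR (- (wordsum lam w2 * (m - u))) - 1| <= B * (v - u).
    by apply: le_trans (s1 um) _; rewrite ler_wpM2l//; lra.
  have X13 := ler_pM (normr_ge0 _) (normr_ge0 _) X3 X1.
  have X123 := ler_pM (mulr_ge0 (normr_ge0 _) (normr_ge0 _)) (normr_ge0 _) X13 X2.
  apply: le_trans X123 _.
  have -> : B * (v - u) * (c1 * (v - u) `^ alpha) * (c1 * fade T kappa u * (v - u) `^ alpha) =
    B * c1 * c1 * fade T kappa u * ((v - u) * ((v - u) `^ alpha * (v - u) `^ alpha)) by ring.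
  rewrite ler_wpM2l ?mulr_ge0//.
  by rewrite powR_mulD// (_ : alpha + alpha = 2 * alpha)//; ring.
apply: le_trans (ler_normD _ _) _; apply: le_trans (lerD D1 D2) _.
rewrite -!mulrDl -!mulrA ler_wpM2r ?mulr_ge0//.
by rewrite !mulrA; lra.
Qed.

End RoughPathBounds.

(** * Integration of controlled tensor paths *)

Section ControlledInduction.
Context {R : realType} {d : nat}.

(** The companion of [tmul2] one degree lower: there is no derivative at level zero. *)
Definition tmul1 n : tensor R d n.-1 -> tensor R d 1 -> tensor R d n :=
  match n with
  | 0 => fun _ _ => 0
  | k.+1 => fun z' a => tmul (addn1 k) z' a
  end.

Lemma tbound_tmul1 n (A : tensor R d n.-1) (B : tensor R d 1) c c' :
  0 <= c -> 0 <= c' -> tbound A c -> tbound B c' -> tbound (tmul1 A B) (c * c').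
Proof.
case: n A => [|n] A c0 c0' hA hB /=; first by apply: tbound0; rewrite mulr_ge0.
exact: tbound_tmul.
Qed.

Lemma tmul1_assoc n (z' : tensor R d n.-1) (a a' : tensor R d 1) :
  tmul (addn1 n) (tmul1 z' a) a' = tmul2 z' (tmul (erefl : (1 + 1 = 2)%N) a a').
Proof.
case: n z' => [|n] z' /=; first by apply/ffunP => w; rewrite !ffunE mul0r.
apply/ffunP => w; rewrite !ffunE -mulrA; congr (z' _ * (a _ * a' _)).
- by apply/ffunP => i; rewrite !ffunE; congr (w _); exact: val_inj.
- by apply/ffunP => i; rewrite !ffunE; congr (w _); apply: val_inj; rewrite /= ord1 /= !addn0.
- apply/ffunP => i; rewrite !ffunE; congr (w _); apply: val_inj.
  by rewrite /= ord1 /= !addn0 addn1.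
Qed.

(** The algebra behind the integration of controlled paths: the defect of the germ
    is made of the defects of [a] and [b] and of the remainders of [z] and [z'], the
    product of the first-order term of [z] with [a] being cancelled by the
    product in Chen's identity. *)
Lemma germ_defectE n (z0 z1 : tensor R d n) (z0' z1' : tensor R d n.-1)
    (auv aum amv : tensor R d 1) (buv bum bmv : tensor R d 2) :
  germ z0 z0' auv buv - germ z0 z0' aum bum - germ z1 z1' amv bmv =
    tmul (addn1 n) z0 (auv - aum - amv) +
    tmul2 z0' (buv - bum - bmv - tmul (erefl : (1 + 1 = 2)%N) aum amv) -
    tmul (addn1 n) (z1 - z0 - tmul1 z0' aum) amv - tmul2 (z1' - z0') bmv.
Proof.
have -> : tmul (addn1 n) (z1 - z0 - tmul1 z0' aum) amv =
    tmul (addn1 n) (z1 - z0) amv - tmul2 z0' (tmul (erefl : (1 + 1 = 2)%N) aum amv).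
  by rewrite -tmul1_assoc; apply/ffunP => w; rewrite !ffunE; ring.
rewrite /germ; case: n z0 z1 z0' z1' => [|n] z0 z1 z0' z1' /=;
  by apply/ffunP => w; rewrite !ffunE; ring.
Qed.

Variables (T alpha kappa : R) (s : \bar R).
Hypotheses (alpha0 : 0 < alpha) (alpha3 : 1 < 3 * alpha) (kappa0 : 0 < kappa).

(** [z'] is the derivative of [z] with respect to [a] in the sense of controlled
    rough paths, with one constant for the sizes and for both remainders. *)
Definition controlled C n (z : R -> tensor R d n) (z' : R -> tensor R d n.-1)
    (a : R -> R -> tensor R d 1) :=
  (forall u, (s <= u%:E)%E -> u <= T -> tbound (z u) C /\ tbound (z' u) C) /\
  (forall u v, (s <= u%:E)%E -> u <= v -> v <= T -> v - u < 1 ->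
     tbound (z' v - z' u) (C * (v - u) `^ alpha) /\
     tbound (z v - z u - tmul1 (z' u) (a u v)) (C * (v - u) `^ (2 * alpha))).

(** The properties of [primitive_exists] for all the coefficients of a germ. *)
Definition is_primitive C n (z : R -> tensor R d n) (z' : R -> tensor R d n.-1)
    (a : R -> R -> tensor R d 1) (b : R -> R -> tensor R d 2)
    (Z : R -> tensor R d n.+1) :=
  [/\ forall w r t, (s <= r%:E)%E -> r <= t -> t <= T ->
        sewn (fun u v => germ (z u) (z' u) (a u v) (b u v) w) r t (Z t w - Z r w),
      forall t, (s <= t%:E)%E -> t <= T ->
        tbound (Z t) (prim_const kappa (3 * alpha) * C * fade T kappa t) &
      forall r, s = r%:E -> r <= T -> Z r = 0].

Variables (C c : R).
Hypotheses (C0 : 0 <= C) (c0 : 0 <= c).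

Definition germ_const : R := 2 * (C * c) * (1 + expR kappa).

Lemma germ_const_ge0 : 0 <= germ_const.
Proof. by rewrite !mulr_ge0 ?addr_ge0 ?expR_ge0. Qed.

Variables (n : nat) (z : R -> tensor R d n) (z' : R -> tensor R d n.-1).
Variables (a : R -> R -> tensor R d 1) (b : R -> R -> tensor R d 2).
Hypotheses (hz : controlled C z z' a) (hab : almost_rough T alpha kappa c a b).

Let Xi w u v := germ (z u) (z' u) (a u v) (b u v) w.

(** Each of the four terms of [germ_defectE] is a product of orders [0 + 3 alpha] or
    [alpha + 2 alpha]. The last two contain [fade m] instead of [fade u], which
    costs the factor [exp kappa] in [germ_const]. *)
Lemma germ_defect w u m v : (s <= u%:E)%E -> u <= m -> m <= v -> v <= T -> v - u < 1 ->
  `|Xi w u v - Xi w u m - Xi w m v| <=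
    germ_const * fade T kappa u * (v - u) `^ (3 * alpha).
Proof.
move=> su um mv vT uv1.
have a20 : 0 < 2 * alpha by rewrite mulr_gt0.
have sm : (s <= m%:E)%E by apply: le_trans su _; rewrite lee_fin.
have [mu1 vm1] : m - u < 1 /\ v - m < 1 by split; lra.
have mT := le_trans mv vT; have uT := le_trans um mT; have uv := le_trans um mv.
have [_ _ d1 d2] := hab um mv vT uv1.
have [a1 b1 _ _] := hab mv (lexx v) vT vm1.
have [hz1 hz2] := hz.
have [zu zu'] := hz1 u su uT.
have [dz' dz] := hz2 u m su um mT mu1.
have f0 := fade_ge0 T kappa u; have fm0 := fade_ge0 T kappa m.
have fmu : fade T kappa m <= expR kappa * fade T kappa u by exact: fade_shift.
set h := v - u in uv1 d1 d2 *.
have h3 := powR_ge0 h (3 * alpha).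
have h01 : 0 <= h by rewrite subr_ge0.
have K1 : tbound (tmul (addn1 n) (z m - z u - tmul1 (z' u) (a u m)) (a m v))
    (C * c * expR kappa * fade T kappa u * h `^ (3 * alpha)).
  apply: tboundW (tbound_tmul (addn1 n) dz a1).
  apply: (@le_trans _ _ ((C * h `^ (2 * alpha)) * (c * (expR kappa * fade T kappa u) * h `^ alpha))).
    apply: ler_pM; rewrite ?mulr_ge0 ?powR_ge0//.
      by rewrite ler_wpM2l// powR_le_base ?(ltW a20)// subr_ge0 um /h; lra.
    apply: ler_pM; rewrite ?mulr_ge0 ?powR_ge0 ?ler_wpM2l//.
    by rewrite powR_le_base ?(ltW alpha0)// subr_ge0 mv /h; lra.
  rewrite (_ : 3 * alpha = 2 * alpha + alpha); last by ring.
  by rewrite -powR_mulD// le_eqVlt; apply/orP; left; apply/eqP; ring.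
have K2 : tbound (tmul2 (z' m - z' u) (b m v))
    (C * c * expR kappa * fade T kappa u * h `^ (3 * alpha)).
  apply: tboundW (tbound_tmul2 _ _ dz' b1); rewrite ?mulr_ge0 ?powR_ge0//.
  apply: (@le_trans _ _ ((C * h `^ alpha) * (c * (expR kappa * fade T kappa u) * h `^ (2 * alpha)))).
    apply: ler_pM; rewrite ?mulr_ge0 ?powR_ge0//.
      by rewrite ler_wpM2l// powR_le_base ?(ltW alpha0)// subr_ge0 um /h; lra.
    apply: ler_pM; rewrite ?mulr_ge0 ?powR_ge0 ?ler_wpM2l//.
    by rewrite powR_le_base ?(ltW a20)// subr_ge0 mv /h; lra.
  rewrite (_ : 3 * alpha = alpha + 2 * alpha); last by ring.
  by rewrite -powR_mulD// le_eqVlt; apply/orP; left; apply/eqP; ring.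
have K3 := tbound_tmul (addn1 n) zu d1.
have K4 := tbound_tmul2 C0 _ zu' d2.
have {}K4 := K4 (mulr_ge0 (mulr_ge0 c0 f0) h3).
have K := tboundB (tboundB (tboundD K3 K4) K1) K2.
rewrite -germ_defectE in K.
have := K w; rewrite !tensorBE => /le_trans; apply.
rewrite /germ_const le_eqVlt; apply/orP; left; apply/eqP; ring.
Qed.

Lemma germ_bound w u v : (s <= u%:E)%E -> u <= v -> v <= T -> v - u < 1 ->
  `|Xi w u v| <= germ_const * fade T kappa u.
Proof.
move=> su uv vT uv1.
have a20 : 0 < 2 * alpha by rewrite mulr_gt0.
have [a1 b1 _ _] := hab uv (lexx v) vT uv1.
have [zu zu'] := (proj1 hz) u su (le_trans uv vT).
have f0 := fade_ge0 T kappa u.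
have h01 : 0 <= v - u <= 1 by apply/andP; split; lra.
have pw1 x : 0 < x -> (v - u) `^ x <= 1.
  by move=> x0; have := powR_le_base h01 (ltW x0); rewrite powR1.
have cf : 0 <= c * fade T kappa u by rewrite mulr_ge0.
have a2 : tbound (a u v) (c * fade T kappa u).
  by apply: tboundW a1; rewrite ler_piMr ?pw1.
have b2 : tbound (b u v) (c * fade T kappa u).
  by apply: tboundW b1; rewrite ler_piMr ?pw1.
have := tboundD (tbound_tmul (addn1 n) zu a2) (tbound_tmul2 C0 cf zu' b2) w.
move=> /le_trans; apply; rewrite /germ_const.
have : 0 <= C * (c * fade T kappa u) by rewrite mulr_ge0.
have := expR_ge0 kappa; set e := expR kappa; set X := C * _ => e0 X0.
have -> : 2 * (C * c) * (1 + e) * fade T kappa u = 2 * X + 2 * (e * X) by rewrite /X; ring.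
by have := mulr_ge0 e0 X0; lra.
Qed.

Lemma tensor_primitive_exists : exists Z : R -> tensor R d n.+1,
  is_primitive germ_const z z' a b Z.
Proof.
have h w := primitive_exists kappa0 alpha3 germ_const_ge0 (germ_defect w) (germ_bound w).
have [Z hZ] := boolp.choice h.
exists (fun t => [ffun w => Z w t]); split.
- by move=> w r t sr rt tT; rewrite !ffunE; have [+ _ _] := hZ w; apply.
- by move=> t st tT w; rewrite !ffunE; have [_ + _] := hZ w; apply.
- by move=> r sr rT; apply/ffunP => w; rewrite !ffunE; have [_ _ +] := hZ w; apply.
Qed.

Definition next_const : R :=
  prim_const kappa (3 * alpha) * germ_const + (C + C * c) +
  (sew_const (3 * alpha) * expR kappa * germ_const + C * c).

Lemma next_const_ge0 : 0 <= next_const.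
Proof.
have := prim_const_ge0 kappa0 alpha3; have := sew_const_ge0 alpha3.
have := germ_const_ge0; have := expR_ge0 kappa => *.
by rewrite !addr_ge0 ?mulr_ge0.
Qed.

(** The primitive is controlled with derivative [z]: it differs from its germ by a
    term of order [3 alpha], and the part of the germ with [b] is of order [2 alpha]. *)
Lemma primitive_controlled Z : is_primitive germ_const z z' a b Z ->
  controlled next_const (n := n.+1) Z z a.
Proof.
move=> [Z1 Z2 _].
have a20 : 0 < 2 * alpha by rewrite mulr_gt0.
have p0 := prim_const_ge0 kappa0 alpha3; have s0 := sew_const_ge0 alpha3.
have g0 := germ_const_ge0; have e0 := expR_ge0 kappa.
have pg0 := mulr_ge0 p0 g0; have sg0 := mulr_ge0 (mulr_ge0 s0 e0) g0.
have Cc0 := mulr_ge0 C0 c0; have C0' := C0.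
split=> [u su uT|u v su uv vT uv1].
  split; last by apply: tboundW (proj1 (proj1 hz u su uT)); rewrite /next_const; lra.
  apply: tboundW (Z2 u su uT).
  apply: le_trans (_ : prim_const kappa (3 * alpha) * germ_const <= _).
    by rewrite ler_piMr// fade_le1.
  by rewrite /next_const; lra.
have uT := le_trans uv vT.
have [a1 b1 _ _] := hab uv (lexx v) vT uv1.
have [zu zu'] := (proj1 hz) u su uT.
have [dz' dz] := (proj2 hz) u v su uv vT uv1.
have f0 := fade_ge0 T kappa u; have f1 := fade_le1 kappa0 uT.
have h01 : 0 <= v - u <= 1 by apply/andP; split; lra.
have h1 := powR_ge0 (v - u) alpha; have h2 := powR_ge0 (v - u) (2 * alpha).
have h3 := powR_ge0 (v - u) (3 * alpha).
have h21 : (v - u) `^ (2 * alpha) <= (v - u) `^ alpha.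
  by apply: powR_le_exp => //; rewrite alpha0 ler_peMl ?ler1n// ltW.
have h32 : (v - u) `^ (3 * alpha) <= (v - u) `^ (2 * alpha).
  by apply: powR_le_exp => //; rewrite a20 ler_pM2r// ler_nat.
have a2 : tbound (a u v) (c * (v - u) `^ alpha).
  by apply: tboundW a1; rewrite ler_wpM2r// ler_piMr.
have b2 : tbound (b u v) (c * (v - u) `^ (2 * alpha)).
  by apply: tboundW b1; rewrite ler_wpM2r// ler_piMr.
split.
  have -> : z v - z u = z v - z u - tmul1 (z' u) (a u v) + tmul1 (z' u) (a u v).
    by rewrite subrK.
  apply: tboundW (tboundD dz (tbound_tmul1 C0 (mulr_ge0 c0 h1) zu' a2)).
  have A := ler_wpM2l C0 h21.
  apply: (@le_trans _ _ ((C + C * c) * (v - u) `^ alpha)); first by lra.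
  by rewrite ler_wpM2r//; rewrite /next_const; lra.
have -> : Z v - Z u - tmul1 (n := n.+1) (z u) (a u v) =
    - (germ (z u) (z' u) (a u v) (b u v) - (Z v - Z u)) + tmul2 (z' u) (b u v).
  by rewrite /germ /=; apply/ffunP => w; rewrite !ffunE; ring.
have loc : tbound (germ (z u) (z' u) (a u v) (b u v) - (Z v - Z u))
   (sew_const (3 * alpha) * expR kappa * germ_const * (v - u) `^ (2 * alpha)).
  move=> w.
  have := sewn_local_fade kappa0 alpha3 g0 (germ_defect w) su uv vT uv1 (Z1 w u v su uv vT).
  rewrite !tensorBE => /le_trans; apply.
  apply: ler_pM; rewrite ?mulr_ge0// -[leRHS]mulrA.
  by do 2 apply: ler_wpM2l => //; rewrite ler_piMr.
apply: tboundW (tboundD (tboundN loc) (tbound_tmul2 C0 (mulr_ge0 c0 h2) zu' b2)).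
rewrite (mulrA C) -mulrDl ler_wpM2r// /next_const; lra.
Qed.

End ControlledInduction.

(** * Approximation by one partition for all integrands *)

Section UniformApproximation.
Context {R : realType} {d : nat}.
Variables (T alpha kappa : R) (s : \bar R).
Hypotheses (alpha0 : 0 < alpha) (alpha3 : 1 < 3 * alpha) (kappa0 : 0 < kappa).
Variables (C c : R).
Hypotheses (C0 : 0 <= C) (c0 : 0 <= c).

Let K := prim_const kappa (3 * alpha) * germ_const kappa C c.

Let K0 : 0 <= K.
Proof. by rewrite mulr_ge0 ?prim_const_ge0 ?germ_const_ge0. Qed.

Lemma primitive_small_past eps : 0 < eps ->
  exists r0, forall r, r <= r0 -> (s <= r%:E)%E -> r <= T ->
    forall n z z' a b (Z : R -> tensor R d n.+1),
      is_primitive T alpha kappa s (germ_const kappa C c) z z' a b Z ->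
      forall w, `|Z r w| < eps.
Proof.
move=> e0; have K1 : 0 < K + 1 by rewrite ltr_wpDl.
have [r0 hr0] := fade_to0 T kappa0 (divr_gt0 e0 K1).
exists r0 => r rr0 sr rT n z z' a b Z [_ hZ _] w; apply: le_lt_trans (hZ r sr rT w) _.
have := hr0 r rr0; rewrite ltr_pdivlMr// => h; apply: le_lt_trans h.
by rewrite mulrC ler_wpM2l ?fade_ge0// lerDl.
Qed.

(** One partition serves all integrands with the constants [C] and [c]. If [s] is finite, it
    starts at [s]; if [s] is infinite, it starts so far in the past that all
    the primitives are small there. *)
Lemma uniform_partition_approximation t eps : (s <= t%:E)%E -> t <= T -> 0 < eps ->
  exists r P, [/\ (s <= r%:E)%E, itv_partition r t P, finer_than 1 r P &
    forall n z z' a b (Z : R -> tensor R d n.+1),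
      controlled T alpha s C z z' a -> almost_rough T alpha kappa c a b ->
      is_primitive T alpha kappa s (germ_const kappa C c) z z' a b Z ->
      forall w, `|Z t w - psum (fun u v => germ (z u) (z' u) (a u v) (b u v) w) r P| < eps].
Proof.
move=> st tT e0.
have e20 : 0 < eps / 2 by rewrite divr_gt0.
have [r [sr rt hr]] : exists r, [/\ (s <= r%:E)%E, r <= t &
    forall n z z' a b (Z : R -> tensor R d n.+1),
      is_primitive T alpha kappa s (germ_const kappa C c) z z' a b Z ->
      forall w, `|Z r w| < eps / 2].
  have [r0 hr0] := primitive_small_past e20.
  case: s st hr0 => [r rt _|//|_ hr0].
    exists r; split => // n z z' a b Z [_ _ h] w; rewrite h ?ffunE ?normr0//.
    by apply: le_trans tT; rewrite lee_fin in rt.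
  exists (Num.min r0 t); split; rewrite ?leNye ?ge_min ?lexx ?orbT//.
  move=> n z z' a b Z; apply: hr0; rewrite ?leNye ?ge_min ?lexx//.
  by rewrite tT orbT.
have g0 : 0 <= germ_const kappa C c * fade T kappa t.
  by rewrite mulr_ge0 ?germ_const_ge0 ?fade_ge0.
have [D /andP[D0 D1] hD] := psum_pow_gap_small alpha3 e20 rt
  (mulr_ge0 (sew_const_ge0 alpha3) g0).
have [P hP fP] := finer_partition_exists D0 rt.
exists r, P; split => //; first exact: finer_thanW fP.
move=> n z z' a b Z hz hab hZ w.
have hZr := hr _ _ _ _ _ _ hZ w.
have [Z1 _ _] := hZ.
(* on [r, t] the weight of the defect is at most its value at [t] *)
have sw := Xi_sewable kappa0 (germ_const_ge0 kappa C0 c0)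
  (germ_defect alpha0 kappa0 C0 c0 hz hab w) sr tT.
have est := sewn_estimate alpha3 g0 rt sw (Z1 w r t sr rt tT) hP (finer_thanW D1 fP).
have := le_lt_trans est (hD P hP fP).
by move: hZr; rewrite !ltr_norml => /andP[? ?] /andP[? ?]; apply/andP; split; lra.
Qed.

End UniformApproximation.

(** * The levels of the signature as primitives *)

Section EFMSignature.
Context {R : realType} {d : nat}.
Variables (T alpha kappa : R) (lam : 'rV[R]_d) (s : \bar R).
Hypotheses (alpha0 : 0 < alpha) (alpha3 : 1 < 3 * alpha) (kappa0 : 0 < kappa).

(** Level [n] of the undamped signature, and the level below it. *)
Definition nsig (Y : two_level R d) n t := Dop lam (- t) (efm_sig lam Y n s t).
Definition nsig' (Y : two_level R d) n t := Dop lam (- t) ((efm_pair lam Y s n).2 t).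

Lemma Dop_tone h : Dop lam h (tone R d) = tone R d.
Proof. by apply/ffunP => w; rewrite !ffunE /wordsum big_ord0 mul0r oppr0 expR0 mul1r. Qed.

Lemma efm_primitive C c Y n : 0 <= C -> 0 <= c ->
  controlled T alpha s C (nsig Y n) (nsig' Y n) (nlev1 lam Y) ->
  almost_rough T alpha kappa c (nlev1 lam Y) (nlev2 lam Y) ->
  is_primitive T alpha kappa s (germ_const kappa C c)
    (nsig Y n) (nsig' Y n) (nlev1 lam Y) (nlev2 lam Y) (nsig Y n.+1).
Proof.
move=> C0 c0 hz hab.
have [Z hZ] := tensor_primitive_exists alpha0 alpha3 kappa0 C0 c0 hz hab.
have ZE t : (s <= t%:E)%E -> t <= T -> nsig Y n.+1 t = Z t.
  move=> st tT; rewrite /nsig.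
  have -> : efm_sig lam Y n.+1 s t = Dop lam t [ffun w => Z t w].
    have [Z1 Z2 Z3] := hZ.
    apply: (@rough_convE R d lam Y n _ _ T s (fun w t => Z t w)) => //.
    - by move=> w r sr rT; rewrite Z3// ffunE.
    - move=> soo w eps e0.
      have [r0 hr0] := @primitive_small_past R d T alpha kappa s alpha3 kappa0 C c C0 c0 eps e0.
      exists (Num.min r0 T) => r; rewrite le_min => /andP[rr0 rT].
      by apply: hr0 hZ w => //; rewrite soo leNye.
  rewrite DopDop addNr; apply/ffunP => w; rewrite !ffunE.
  by rewrite mulr0 oppr0 expR0 mul1r.
have [Z1 Z2 Z3] := hZ; split.
- move=> w r t sr rt tT; have st : (s <= t%:E)%E by apply: le_trans sr _; rewrite lee_fin.
  by rewrite !ZE ?(le_trans rt tT)//; exact: Z1.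
- by move=> t st tT; rewrite ZE//; exact: Z2.
- by move=> r sr rT; rewrite ZE ?sr//; exact: Z3.
Qed.

(** Level [n] is controlled by level [n - 1], with a constant that depends on the path
    only through the constant of [almost_rough]. *)
Lemma efm_controlled c n : 0 <= c -> exists2 C, 0 <= C & forall Y,
  almost_rough T alpha kappa c (nlev1 lam Y) (nlev2 lam Y) ->
  controlled T alpha s C (nsig Y n) (nsig' Y n) (nlev1 lam Y).
Proof.
move=> c0; elim: n => [|n [C C0 IH]].
  exists 1 => // Y _; split=> [u su uT|u v su uv vT uv1].
    split; first by rewrite /nsig Dop_tone => w; rewrite ffunE normr1.
    by rewrite /nsig' /= Dop0; exact: tbound0.
  rewrite /nsig /nsig' !Dop_tone /= !Dop0 !subr0 subrr.
  by split; apply: tbound0; rewrite mul1r powR_ge0.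
exists (next_const alpha kappa C c); first exact: next_const_ge0.
move=> Y hY; have hz := IH Y hY.
exact: primitive_controlled (efm_primitive C0 c0 hz hY).
Qed.

End EFMSignature.

Lemma distr_lt_third (R : realType) (x y p q e : R) :
  `|x - p| < e / 3 -> `|y - q| < e / 3 -> `|p - q| < e / 3 -> `|x - y| < e.
Proof.
rewrite !ltr_norml => /andP[? ?] /andP[? ?] /andP[? ?].
by apply/andP; split; lra.
Qed.

(** * Continuity *)

Section Continuity.
Context {R : realType} {d : nat}.
Variables (T alpha kappa : R) (lam rho : 'rV[R]_d) (s : \bar R).
Hypotheses (alpha0 : 0 < alpha) (alpha_half : alpha <= 2^-1) (alpha3 : 1 < 3 * alpha).
Hypotheses (kappa0 : 0 < kappa) (lam_rho : forall i, 0 < rho 0 i < lam 0 i).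
Hypothesis kappa_le : forall i, kappa <= lam 0 i - rho 0 i.
Variable X : two_level R d.
Hypothesis hX : rough_path T alpha rho X.

(** The neighbourhoods of [X] for the rough distance, as a filter on pairs, so that
    continuity at [X] becomes convergence along it. *)
Definition rough_nbhs : set_system (two_level R d) :=
  filter_from [set e : R | 0 < e]
    (fun e => [set Y | rough_path T alpha rho Y /\ (rough_dist T alpha rho X Y < e%:E)%E]).

#[local] Instance rough_nbhs_filter : Filter rough_nbhs.
Proof.
apply: filter_from_filter; first by exists 1 => /=.
move=> e f /= e0 f0; exists (Num.min e f); first by rewrite /= lt_min e0.
move=> Y /= [hY h]; split; split => //; apply: lt_le_trans h _.
  by rewrite lee_fin ge_min lexx.
by rewrite lee_fin ge_min lexx orbT.
Qed.

(** The distance controls each coefficient on each interval of length less than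
    one, with a factor that depends on the interval. *)
Lemma level_cvg n beta (A : two_level R d -> R -> R -> tensor R d n) u v w :
  (forall Y del, (rough_dist T alpha rho X Y < del%:E)%E ->
    level_bounded T rho beta del (fun u v => A X u v - A Y u v)) ->
  u < v -> v <= T -> v - u < 1 -> A Y u v w @[Y --> rough_nbhs] --> A X u v w.
Proof.
move=> h uv vT uv1; apply/cvgrPdist_lt => e e0.
set k := expR (wordsum rho w * (T - u)) * (v - u) `^ beta.
have k0 : 0 < k by rewrite mulr_gt0 ?expR_gt0 ?powR_gt0 ?subr_gt0.
have ek : 0 < e / k / 2 by rewrite !divr_gt0.
exists (e / k / 2) => //= Y [hY hXY].
have := h Y _ hXY u v w uv vT uv1; rewrite tensorBE => /le_lt_trans; apply.
rewrite -mulrA -/k mulrAC divfK ?gt_eqF//; lra.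
Qed.

Lemma nlev1_cvg u v w : u < v -> v <= T -> v - u < 1 ->
  nlev1 lam Y u v w @[Y --> rough_nbhs] --> nlev1 lam X u v w.
Proof.
move=> uv vT uv1; rewrite ffunE; under eq_fun do rewrite ffunE.
apply: cvgM; first exact: cvg_cst.
apply: (level_cvg (A := @lev1 R d) (beta := alpha)) => // Y del h.
by have [] := rough_dist_level_bounded h.
Qed.

Lemma nlev2_cvg u v w : u < v -> v <= T -> v - u < 1 ->
  nlev2 lam Y u v w @[Y --> rough_nbhs] --> nlev2 lam X u v w.
Proof.
move=> uv vT uv1; rewrite ffunE; under eq_fun do rewrite ffunE.
apply: cvgM; first exact: cvg_cst.
apply: (level_cvg (A := @lev2 R d) (beta := 2 * alpha)) => // Y del h.
by have [] := rough_dist_level_bounded h.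
Qed.

Lemma tmul_cvg n m p (e : (n + m)%N = p) (A : two_level R d -> tensor R d n)
    (B : two_level R d -> tensor R d m) :
  (forall w, A Y w @[Y --> rough_nbhs] --> A X w) ->
  (forall w, B Y w @[Y --> rough_nbhs] --> B X w) ->
  forall w, tmul e (A Y) (B Y) w @[Y --> rough_nbhs] --> tmul e (A X) (B X) w.
Proof.
move=> hA hB w; rewrite ffunE; under eq_fun do rewrite ffunE.
exact: cvgM (hA _) (hB _).
Qed.

Lemma germ_cvg n (z : two_level R d -> tensor R d n) (z' : two_level R d -> tensor R d n.-1)
    (a : two_level R d -> tensor R d 1) (b : two_level R d -> tensor R d 2) :
  (forall w, z Y w @[Y --> rough_nbhs] --> z X w) ->
  (forall w, z' Y w @[Y --> rough_nbhs] --> z' X w) ->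
  (forall w, a Y w @[Y --> rough_nbhs] --> a X w) ->
  (forall w, b Y w @[Y --> rough_nbhs] --> b X w) ->
  forall w, germ (z Y) (z' Y) (a Y) (b Y) w @[Y --> rough_nbhs] -->
    germ (z X) (z' X) (a X) (b X) w.
Proof.
move=> hz hz' ha hb w; rewrite ffunE; under eq_fun do rewrite ffunE.
have h1 : tmul (addn1 n) (z Y) (a Y) w @[Y --> rough_nbhs] --> tmul (addn1 n) (z X) (a X) w.
  exact: tmul_cvg.
suff h2 : tmul2 (z' Y) (b Y) w @[Y --> rough_nbhs] --> tmul2 (z' X) (b X) w by exact: cvgD.
case: n z z' w hz hz' {h1} => [|n] z z' w hz hz' /=; last exact: tmul_cvg.
exact: cvg_cst.
Qed.

Lemma psum_cvg (f : two_level R d -> R -> R -> R) r t P :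
  itv_partition r t P -> finer_than 1 r P -> t <= T ->
  (forall u v, r <= u -> u < v -> v <= t -> v - u < 1 ->
     f Y u v @[Y --> rough_nbhs] --> f X u v) ->
  psum (f Y) r P @[Y --> rough_nbhs] --> psum (f X) r P.
Proof.
elim: P r => [|p P IH] r.
  by move=> *; rewrite psum_nil; under eq_fun do rewrite psum_nil; exact: cvg_cst.
move=> /itv_partition_consE[rp hP]; rewrite finer_than_cons => /andP[rp1 fP] tT h.
rewrite psum_cons; under eq_fun do rewrite psum_cons.
apply: cvgD; first by apply: h => //; exact: itv_partition_le hP.
by apply: IH => // u v pu; apply: h; exact: le_trans (ltW rp) pu.
Qed.

(** Along rough paths near [X], one partition sum approximates the next level
    uniformly, and that finite sum converges by the induction hypothesis at the
    points of the partition. *)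
Lemma nsig_cvg n : forall t, (s <= t%:E)%E -> t <= T ->
  (forall w, nsig lam s Y n t w @[Y --> rough_nbhs] --> nsig lam s X n t w) /\
  (forall w, nsig' lam s Y n t w @[Y --> rough_nbhs] --> nsig' lam s X n t w).
Proof.
have [M [M0 bX bY]] := ball_bounded hX.
have [c c0 hc] := rough_path_almost_rough T alpha0 alpha_half lam_rho kappa0 M0 kappa_le.
elim: n => [|n IH] t st tT.
  split => w; first by rewrite /nsig /efm_sig /=; exact: cvg_cst.
  by rewrite /nsig' /=; exact: cvg_cst.
split; last by move=> w; have [+ _] := IH t st tT; exact.
move=> w; have [C C0 hC] := efm_controlled T lam s alpha0 alpha3 kappa0 n c0.
apply/cvgrPdist_lt => e e0.
have e30 : 0 < e / 3 by rewrite divr_gt0.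
have [r [P [sr hP fP happ]]] :=
  @uniform_partition_approximation R d T alpha kappa s alpha0 alpha3 kappa0 C c C0 c0 t (e / 3) st tT e30.
have approx Y : bounded_rough T alpha rho M Y ->
    `|nsig lam s Y n.+1 t w - psum (ngerm lam Y (efm_sig lam Y n s) (efm_pair lam Y s n).2 w) r P|
      < e / 3.
  move=> hY; have aY := hc Y hY; have hz := hC Y aY.
  exact: happ hz aY (efm_primitive alpha0 alpha3 kappa0 C0 c0 hz aY) w.
have hpsum : psum (ngerm lam Y (efm_sig lam Y n s) (efm_pair lam Y s n).2 w) r P
    @[Y --> rough_nbhs] --> psum (ngerm lam X (efm_sig lam X n s) (efm_pair lam X s n).2 w) r P.
  apply: (psum_cvg (f := fun Y => ngerm lam Y (efm_sig lam Y n s) (efm_pair lam Y s n).2 w) hP fP tT).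
  move=> u v ru uv vt uv1; have vT := le_trans vt tT.
  have su : (s <= u%:E)%E by apply: le_trans sr _; rewrite lee_fin.
  have [h1 h2] := IH u su (le_trans (ltW uv) vT).
  apply: (germ_cvg (z := fun Y => nsig lam s Y n u) (z' := fun Y => nsig' lam s Y n u)
     (a := fun Y => nlev1 lam Y u v) (b := fun Y => nlev2 lam Y u v)) => // w'.
    exact: nlev1_cvg.
  exact: nlev2_cvg.
move/cvgrPdist_lt: hpsum => /(_ _ e30).
have near1 : rough_nbhs [set Y | bounded_rough T alpha rho M Y].
  by exists 1 => //= Y [hY hXY]; exact: bY.
apply: filterS2 near1 => Y hY /=.
exact: distr_lt_third (approx X bX) (approx Y hY).
Qed.

Lemma efm_sig_cvg n t : (s <= t%:E)%E -> t <= T ->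
  tnorm (efm_sig lam Y n s t - efm_sig lam X n s t) @[Y --> rough_nbhs] --> (0 : R).
Proof.
move=> st tT; apply/tnorm_cvg0P => w.
have E Y : efm_sig lam Y n s t w = expR (- (wordsum lam w * t)) * nsig lam s Y n t w.
  by rewrite ffunE mulrA -expRD mulrN opprK addNr expR0 mul1r.
rewrite E; under eq_fun do rewrite E.
apply: cvgM; first exact: cvg_cst.
by have [+ _] := nsig_cvg n st tT; exact.
Qed.

End Continuity.

Lemma tnorm_subC (R : realType) (d n : nat) (A B : tensor R d n) :
  tnorm (A - B) = tnorm (B - A).
Proof.
by congr Num.sqrt; apply: eq_bigr => w _; rewrite !tensorBE -sqrrN opprB.
Qed.

Theorem theorem3p14 (R : realType) (d : nat) (hd : (1 <= d)%N) (T : R)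
  (lam : 'rV[R]_d) (hlam : forall i, 0 < lam 0 i)
  (alpha : R) (halpha : 3^-1 < alpha <= 2^-1)
  (rho : 'rV[R]_d) (hrho : forall i, 0 < rho 0 i < lam 0 i)
  (s : \bar R) (t : R) (hst : (s <= t%:E)%E) (htT : t <= T) (n : nat)
  (X : two_level R d) (hX : rough_path T alpha rho X) :
  forall eps : R, 0 < eps -> exists2 delta : R, 0 < delta &
    forall Y : two_level R d, rough_path T alpha rho Y ->
      (rough_dist T alpha rho X Y < delta%:E)%E ->
      tnorm (efm_sig lam X n s t - efm_sig lam Y n s t) < eps.
Proof.
move=> eps eps0; have /andP[a3 a2] := halpha.
have alpha0 : 0 < alpha by lra.
have alpha3 : 1 < 3 * alpha by lra.
have gap0 i : 0 < lam 0 i - rho 0 i by have /andP[_] := hrho i; rewrite subr_gt0.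
have [kappa kappa0 hkappa] := finite_positive_lower_bound gap0.
have FF : Filter (rough_nbhs T alpha rho X) by exact: rough_nbhs_filter.
have := efm_sig_cvg alpha0 a2 alpha3 kappa0 hrho hkappa hX n hst htT.
move/cvgrPdist_lt => /(_ _ eps0) [delta /= delta0 h].
exists delta => // Y hY hXY; have := h Y (conj hY hXY).
by rewrite /= sub0r normrN ger0_norm ?sqrtr_ge0// tnorm_subC.
Qed.
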